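(* Let $L$ be an oriented link and let $v\in\mathbb G(L)$. Assume that $v$ is the unique minimizer of the functional induced by the canonical cohomology class $\mathbb 1^*$. Then, the evaluation $\mathbf x=(x,\dots,x)$ of $F_L^{(v)}(\mathbf x,q)$ gives a well-defined power series $$F_L^{(v)}(x,q)\in x^{-\frac12\langle\mathbb 1^*,v\rangle}\,\mathbb Z[q,q^{-1}][[x]].$$
   Context: **Inverted state sum.** $\beta$ is a braid on $n$ strands, oriented bottom to top, with closure the oriented link $L=L_1\cup\dots\cup L_\ell$ and variables $\mathbf x=(x_1,\dots,x_\ell)$, $\mathbf x^{\mathbf k}=\prod_i x_i^{k_i}$. $V_\beta$ is the set of crossings, $E_\beta$ the set of segments obtained by cutting the closed braid at its crossings, $b_1,\dots,b_n$ the bottom segments of the strands, and $\kappa(e)$ the index of the component containing a segment $e$ ($\kappa(r):=\kappa(b_r)$), with the convention $\kappa(1)=1$. The first strand is left open in the closure. At a crossing, $i,j,i',j'$ denote the bottom-left, bottom-right, top-left, top-right segments (or labels on them); the overstrand runs from $i$ to $j'$ at a positive crossing and from $j$ to $i'$ at a negative one. An *inversion datum* is a map $\iota:E_\beta\to\{+,-\}$ such that at each crossing the signs $(\iota(i),\iota(j))\to(\iota(i'),\iota(j'))$ are one of: $(+,-)\to(-,+)$, $(-,+)\to(+,-)$, $(-,-)\to(-,-)$, $(+,+)\to(+,+)$, or additionally $(-,+)\to(-,+)$ at a positive crossing, $(+,-)\to(+,-)$ at a negative crossing. The $-$-segments form a simple multicycle $c_\iota$ on the braid. A *state* compatible with $\iota$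 is $s:E_\beta\to\mathbb Z$ with $s(e)\ge0$ if $\iota(e)=+$, $s(e)<0$ if $\iota(e)=-$, and $i+j=i'+j'$ at each crossing. The ground state $s_0$ is $0$ on $+$-segments and $-1$ on $-$-segments. With $(a;q)_k=\prod_{r=0}^{k-1}(1-aq^r)$ and $\binom mk_q=(q^m;q^{-1})_k/(q;q)_k$, the crossing weights $R_c(s)$ are as follows. Positive crossing ($x$ = variable of overstrand, $y$ = variable of understrand): if $i\ge j'\ge0$ or $0>i\ge j'$, $$q^{\frac{j+j'+1}2+jj'}x^{\frac{i'+j+1}4}y^{\frac{3j'-i+1}4}\tbinom{i}{i-j'}_q\prod_{r=1}^{i-j'}(1-q^{j+r}y);$$ if $j'\ge0>i$, $$q^{\frac{j+j'+1}2+jj'}x^{\frac{i'+j+1}4}y^{\frac{3j'-i+1}4}\tbinom{i}{j'}_q\prod_{r=0}^{j'-i-1}(1-q^{j-r}y)^{-1}.$$ Negative crossing ($x$ = variable of understrand, $y$ = variable of overstrand): if $j\ge i'\ge0$ or $0>j\ge i'$, $$q^{-\frac{i+i'+1}2-ii'}x^{-\frac{3i'-j+1}4}y^{-\frac{j'+i+1}4}\tbinom{j}{j-i'}_{q^{-1}}\prod_{r=1}^{j-i'}(1-q^{-i-r}x^{-1});$$ if $i'\ge0>j$, $$q^{-\frac{i+i'+1}2-ii'}x^{-\frac{3i'-j+1}4}y^{-\frac{j'+i+1}4}\tbinom{j}{i'}_{q^{-1}}\prod_{r=0}^{i'-j-1}(1-q^{-i+r}x^{-1})^{-1}.$$ All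 other weights are $0$; rational expressions are expanded as Laurent series at $x=0$, $y=0$. A state is *valid* if all its crossing weights are nonzero; $\Omega(\iota)$ is the set of valid states compatible with $\iota$ with $s(b_1)=s_0(b_1)$, and $\Omega_{\mathbb R}(\iota)\subset\mathbb R^{E_\beta}$ is its real relaxation, obtained by extending the defining linear equations and inequalities to real labels. Put $P(s)=\prod_{r=2}^n x_{\kappa(r)}^{-1/2}q^{-1/2-s(b_r)}\cdot\prod_{c\in V_\beta}R_c(s)$, let $\mathbf s(\iota)$ be the number of closed components of $c_\iota$, not counting the one containing the open strand, and $$F_{(\beta,\iota)}(\mathbf x,q)=(x_1^{1/2}-x_1^{-1/2})(-1)^{\mathbf s(\iota)}\sum_{s\in\Omega(\iota)}P(s).$$ **Niceness of $(\beta,\iota)$.** Let $X_i(s)$ be the minimal $x_i$-degree of $P(s)$ (an affine function of the labels, extended to real labels), $X(s)=(X_1(s),\dots,X_\ell(s))$ and $\langle\mathbb 1,X(s)\rangle=\sum_iX_i(s)$. The pair $(\beta,\iota)$ is *nice* if there is $N\in\mathbb N$ such that $Q_N(\iota)=\{s\in\Omega_{\mathbb R}(\iota):\langle\mathbb 1,X(s)\rangle\le N\}$ is nonempty and bounded; the paper phrases this equivalently as: for some $N$ there are finitely many $s\in\Omega(\iota)$ for which the total minimal degree of $P(s)$ is at most $N$. **Nice pairs $(L,v)$ and $\mathbb G(L)$.** With $o,u$ the incoming and $o^+,u^+$ the outgoing over-/understrand at a crossing, the weight $W(c)$ of a simple multicycle $c$ is the product of the weights of its steps: at a positive crossing $o\to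 o^+$: $x_{\kappa(u)}$, $u\to u^+$: $1$, $o\to u^+$: $1-x_{\kappa(o)}$; at a negative crossing $o\to o^+$: $x_{\kappa(u)}^{-1}$, $u\to u^+$: $1$, $o\to u^+$: $\frac{x_{\kappa(o)}}{x_{\kappa(u)}}(1-x_{\kappa(o)}^{-1})$. Write $W(c)=\pm\mathbf x^{\mathbf a(c)}\prod_i(1-x_i)^{b_i(c)}$. Let $\rho(\beta)_i=\frac12\big(N_i-\sum_j\mathrm{lk}_\beta(L_i,L_j)\big)$, where $N_i$ is the number of strands belonging to $L_i$, $\mathrm{lk}_\beta(L_i,L_j)$ is the linking number for $i\ne j$ and the signed number of self-crossings of $L_i$ in $\beta$ for $i=j$. The pair $(L,v)$ is *nice* if there is a nice $(\beta,\iota)$ with closure $L$ and $\frac v2=\rho(\beta)+\mathbf a(c_\iota)$; then $F_L^{(v)}:=F_{(\beta,\iota)}$, which is an invariant of $(L,v)$. $\Delta_L$ is the multivariable Alexander polynomial, in half-integer powers, normalized so that $\Delta_L(\mathbf x^{-1})=(-1)^\ell\Delta_L(\mathbf x)$, with Newton polytope $N(\Delta_L)$, and $$\mathbb G(L)=\{v\mid v\in2\,\mathrm{Vert}(N(\Delta_L))\text{ and }(L,v)\text{ is a nice pair}\}.$$ **Minimizer.** $\mathbb 1^*=(1,\dots,1)\in H^1(S^3\setminus L;\mathbb Z)$ in the basis dual to the meridians, so $\langle\mathbb 1^*,w\rangle=\sum_iw_i$. That $v$ is the unique minimizer means $\langle\mathbb 1^*,w\rangle>\langle\mathbb 1^*,\frac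 v2\rangle$ for every $w\in\mathrm{supp}\,\Delta_L$ with $w\ne\frac v2$.
   Formalization: Coefficients are shown to lie in q^{(l-1)/2} Z[q,q^{-1}] (l components), since for even l Z[q,q^{-1}] fails: the positive Hopf link with v=0 gives -q^{1/2}. For knots, where the stated symmetry is impossible, Delta_L is Delta_K/(x^{1/2}-x^{-1/2}) expanded at x=0. *)

(* Defs.v *)
From HB Require Import structures.
From mathcomp Require Import all_boot all_order all_algebra all_fingroup.
From mathcomp Require Import mpoly.
From mathcomp Require Import boolp classical_sets cardinality fsbigop reals.

Set Implicit Arguments.
Unset Strict Implicit.
Unset Printing Implicit Defensive.

Import Order.TTheory GRing.Theory Num.Theory.
Local Open Scope ring_scope.

(* Formal series in x_1, ..., x_l with rational exponents: the series f stands
   for the sum of the f e * x^e.  All the series below have their support in a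
   translate of (N/4)^l, so that the sums defining products are finite (a sum
   \sum_(i \in A) over an infinite support would be 0 by convention). *)

Definition expo (l : nat) := {ffun 'I_l -> rat}.

Definition xe (l : nat) (i : 'I_l) (r : rat) : expo l :=
  [ffun j => if j == i then r else 0].

Definition tdeg (l : nat) (e : expo l) : rat := \sum_i e i.

Definition halve (l : nat) (e : expo l) : expo l := [ffun i => e i / 2%:R].

Definition series (A : Type) (l : nat) := expo l -> A.

Section Series.
Variables (K : fieldType) (l : nat).

Definition smono (e : expo l) (a : K) : series K l :=
  fun k => if k == e then a else 0.

Definition smul (f g : series K l) : series K l :=
  fun k => \sum_(m \in [set: expo l]%classic) f m * g (k - m).

Definition sone : series K l := smono 0 1.

(* 1 - a x_i^r *)
Definition sbinom (i : 'I_l) (r : rat) (a : K) : series K l :=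
  fun k => sone k - smono (xe i r) a k.

(* (1 - a x_i)^-1 = \sum_t a^t x_i^t *)
Definition sgeom (i : 'I_l) (a : K) : series K l :=
  fun k => \sum_(t \in [set: nat]%classic) smono (xe i t%:R) (a ^+ t) k.

(* (1 - a x_i^-1)^-1 = - a^-1 x_i (1 - a^-1 x_i)^-1, expanded at x_i = 0 *)
Definition sgeomV (i : 'I_l) (a : K) : series K l :=
  smul (smono (xe i 1) (- a^-1)) (sgeom i a^-1).

(* substitution of x for all the variables; the result is indexed by the
   exponents of x *)
Definition diag_eval (f : series K l) : rat -> K :=
  fun d => \sum_(k \in [set k | tdeg k = d]%classic) f k.

End Series.

(* Coefficients: rational functions in h = q^{1/2}. *)
Definition qfield : fieldType := {fraction {poly int}}.
Definition qh : qfield := tofrac 'X.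
Definition q : qfield := qh ^+ 2.

(* membership in Z[q, q^-1] *)
Definition in_Zq (a : qfield) : Prop :=
  exists (p : {poly int}) (N : nat),
    a = (map_poly (fun z : int => z%:~R) p).[q] / q ^+ N.

(* Membership in q^{(l-1)/2} Z[q, q^-1], which is Z[q, q^-1] for odd l.  The
   half-integer power is needed for even l: the positive Hopf link with v = 0
   has F = - q^{1/2}. *)
Definition in_shifted_Zq (l : nat) (a : qfield) : Prop :=
  exists2 c : qfield, in_Zq c & a = qh ^+ l.-1 * c.

Definition qpoch (a u : qfield) (k : nat) : qfield :=
  \prod_(r < k) (1 - a * u ^+ r).

Definition qbinom (u : qfield) (m : int) (k : nat) : qfield :=
  qpoch (u ^ m) u^-1 k / qpoch u u k.

(* Crossing weights; i, j, i', j' are the labels of the bottom-left,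
   bottom-right, top-left and top-right segments. *)

Definition good_labels (T : numDomainType) (a b : T) : bool :=
  [|| (b <= a) && (0 <= b), (a < 0) && (b <= a) | (0 <= b) && (a < 0)].

Definition Rpos (l : nat) (x y : 'I_l) (i j i' j' : int) : series qfield l :=
  let pre k := smono
    (xe x ((i' + j + 1)%:~R / 4%:R) + xe y ((3 * j' - i + 1)%:~R / 4%:R))
    (qh ^ (j + j' + 1 + 2 * (j * j')) * qbinom q i `|k|%N) in
  if ((j' <= i) && (0 <= j')) || ((i < 0) && (j' <= i)) then
    smul (pre (i - j'))
      (\big[@smul _ l/@sone _ l]_(1 <= r < `|i - j'|%N.+1)
         sbinom y 1 (q ^ (j + r%:Z)))
  else if (0 <= j') && (i < 0) then
    smul (pre j')
      (\big[@smul _ l/@sone _ l]_(0 <= r < `|j' - i|%N)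
         sgeom y (q ^ (j - r%:Z)))
  else fun=> 0.

Definition Rneg (l : nat) (x y : 'I_l) (i j i' j' : int) : series qfield l :=
  let pre k := smono
    (xe x (- ((3 * i' - j + 1)%:~R / 4%:R)) +
     xe y (- ((j' + i + 1)%:~R / 4%:R)))
    (qh ^ (- (i + i' + 1 + 2 * (i * i'))) * qbinom q^-1 j `|k|%N) in
  if ((i' <= j) && (0 <= i')) || ((j < 0) && (i' <= j)) then
    smul (pre (j - i'))
      (\big[@smul _ l/@sone _ l]_(1 <= r < `|j - i'|%N.+1)
         sbinom x (-1) (q ^ (- i - r%:Z)))
  else if (0 <= i') && (j < 0) then
    smul (pre i')
      (\big[@smul _ l/@sone _ l]_(0 <= r < `|i' - j|%N)
         sgeomV x (q ^ (- i + r%:Z)))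
  else fun=> 0.

(* A braid word on n + 1 strands, read from bottom to top; the letter (i, b)
   crosses the positions i and i + 1 (counted from 0), and is a positive
   crossing iff b.  The bottom of each strand carries the index of the
   component that it belongs to. *)
Record cbraid (l : nat) := CBraid {
  width : nat;
  letters : seq ('I_width * bool);
  colour : {ffun 'I_width.+1 -> 'I_l} }.

Definition lpos (n : nat) (i : 'I_n) : 'I_n.+1 := widen_ord (leqnSn n) i.
Definition rpos (n : nat) (i : 'I_n) : 'I_n.+1 := lift ord0 i.

(* the strand starting at the bottom position r ends at position bperm w r *)
Definition bperm (n : nat) (w : seq ('I_n * bool)) : {perm 'I_n.+1} :=
  (\prod_(c <- w) tperm (lpos c.1) (rpos c.1))%g.

(* The colours are an indexing of the components of the closure by 'I_l. *)
Definition is_link (l : nat) (D : cbraid l) : Prop :=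
  (forall i, exists r, colour D r = i) /\
  (forall r r', colour D r = colour D r' <->
                r' \in porbit (bperm (letters D)) r).

(* Two closed braids represent the same oriented link, with the same ordering
   of its components, iff they are related by the following relation (Markov's
   theorem); every oriented link is the closure of a braid (Alexander). *)
Inductive same_link (l : nat) : cbraid l -> cbraid l -> Prop :=
| sl_refl D : same_link D D
| sl_sym D D' : same_link D D' -> same_link D' D
| sl_trans D D' D'' : same_link D D' -> same_link D' D'' -> same_link D D''
| sl_cancel n (w1 w2 : seq ('I_n * bool)) i b k :
    same_link (CBraid (w1 ++ [:: (i, b); (i, ~~ b)] ++ w2) k)
              (CBraid (w1 ++ w2) k)
| sl_far n (w1 w2 : seq ('I_n * bool)) (i j : 'I_n) b b' k :
    (i.+1 < j)%N ->
    same_link (CBraid (w1 ++ [:: (i, b); (j, b')] ++ w2) k)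
              (CBraid (w1 ++ [:: (j, b'); (i, b)] ++ w2) k)
| sl_braid n (w1 w2 : seq ('I_n * bool)) (i j : 'I_n) b k :
    j = i.+1 :> nat ->
    same_link (CBraid (w1 ++ [:: (i, b); (j, b); (i, b)] ++ w2) k)
              (CBraid (w1 ++ [:: (j, b); (i, b); (j, b)] ++ w2) k)
| sl_conj n (w1 w2 : seq ('I_n * bool)) (k : {ffun 'I_n.+1 -> 'I_l}) :
    same_link (CBraid (w1 ++ w2) k)
              (CBraid (w2 ++ w1) [ffun r => k ((bperm w1)^-1%g r)])
| sl_stab n (w : seq ('I_n * bool)) b (k : {ffun 'I_n.+1 -> 'I_l}) :
    same_link (CBraid w k)
      (CBraid (rcons [seq (widen_ord (leqnSn n) c.1, c.2) | c <- w]
                     (ord_max : 'I_n.+1, b))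
              [ffun r => if unlift ord_max r is Some r' then k r'
                         else k ord_max]).

Section Diagram.
Variables (l : nat) (D : cbraid l).

Local Notation n := (width D).
Local Notation w := (letters D).
Local Notation m := (size w).

Definition crossing := 'I_m.

Definition letter (c : crossing) : 'I_n * bool := tnth (in_tuple w) c.
Definition positive (c : crossing) : bool := (letter c).2.

(* (t, r) is the point of the diagram at position r just above the first t
   crossings. *)
Definition point := ('I_m.+1 * 'I_n.+1)%type.

Definition point_step (p p' : point) : bool :=
  (p.2 == p'.2) &&
  ([exists c : crossing,
      [&& p.1 == widen_ord (leqnSn m) c, p'.1 == lift ord0 c,
          p.2 != lpos (letter c).1 & p.2 != rpos (letter c).1]]
   || ((p.1 == ord_max) && (p'.1 == ord0))).

Definition same_segment : rel point :=
  connect (fun p p' => point_step p p' || point_step p' p).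

(* a segment is the set of the points of the grid that it contains *)
Definition segments : {set {set point}} :=
  [set [set p' | same_segment p p'] | p : point].

Definition segment : finType := {S : {set point} | S \in segments}.

Definition seg (p : point) : segment :=
  exist _ [set p' | same_segment p p'] (imset_f _ isT).

Definition pt_bl (c : crossing) : point :=
  (widen_ord (leqnSn m) c, lpos (letter c).1).
Definition pt_br (c : crossing) : point :=
  (widen_ord (leqnSn m) c, rpos (letter c).1).
Definition bl c := seg (pt_bl c).
Definition br c := seg (pt_br c).
Definition tl (c : crossing) := seg (lift ord0 c, lpos (letter c).1).
Definition tr (c : crossing) := seg (lift ord0 c, rpos (letter c).1).
Definition bottom (r : 'I_n.+1) : segment := seg (ord0, r).

(* kappa: the component of the strand passing through a point *)
Definition kappa (p : point) : 'I_l :=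
  colour D ((bperm (take p.1 w))^-1%g p.2).

(* incoming and outgoing over- and understrands, and their components *)
Definition o_in c := if positive c then bl c else br c.
Definition u_in c := if positive c then br c else bl c.
Definition o_out c := if positive c then tr c else tl c.
Definition u_out c := if positive c then tl c else tr c.
Definition kover c := kappa (if positive c then pt_bl c else pt_br c).
Definition kunder c := kappa (if positive c then pt_br c else pt_bl c).

(* Inversion data, with true for + and false for - *)
Definition signs := {ffun segment -> bool}.

Definition inversion_datum (iota : signs) : Prop :=
  forall c : crossing,
    ((iota (bl c), iota (br c)), (iota (tl c), iota (tr c))) \in
    [:: ((true, false), (false, true));
        ((false, true), (true, false));
        ((false, false), (false, false));
        ((true, true), (true, true));
        if positive c then ((false, true), (false, true))
        else ((true, false), (true, false))].

(* States; T is int for states and the real numbers for the relaxation *)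
Definition compatible (T : numDomainType) (iota : signs)
    (s : {ffun segment -> T}) : Prop :=
  (forall e, if iota e then 0 <= s e else s e < 0) /\
  (forall c, s (bl c) + s (br c) = s (tl c) + s (tr c)).

Definition ground (T : numDomainType) (iota : signs) (e : segment) : T :=
  if iota e then 0 else -1.

Definition state := {ffun segment -> int}.

Definition Rweight (s : state) (c : crossing) : series qfield l :=
  if positive c
  then Rpos (kover c) (kunder c) (s (bl c)) (s (br c)) (s (tl c)) (s (tr c))
  else Rneg (kunder c) (kover c) (s (bl c)) (s (br c)) (s (tl c)) (s (tr c)).

Definition valid (s : state) : Prop :=
  forall c, exists k, Rweight s c k != 0.

Definition Omega (iota : signs) : set state :=
  [set s | [/\ compatible iota s, valid s &
               s (bottom ord0) = ground int iota (bottom ord0)]]%classic.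

(* the inequalities on the labels under which a crossing weight is nonzero *)
Definition OmegaR (R : realType) (iota : signs) : set {ffun segment -> R} :=
  [set s | [/\ compatible iota s,
     forall c, if positive c then good_labels (s (bl c)) (s (tr c))
               else good_labels (s (br c)) (s (tl c)) &
     s (bottom ord0) = ground R iota (bottom ord0)]]%classic.

Definition P (s : state) : series qfield l :=
  smul
    (\big[@smul _ l/@sone _ l]_(r < n)
       smono (xe (colour D (rpos r)) (- (1 / 2%:R)))
             (qh ^ (- 1 - 2 * s (bottom (rpos r)))))
    (\big[@smul _ l/@sone _ l]_(c : crossing) Rweight s c).

(* The minimal x_i-degree of P s.  The factors (1 - a y) and (1 - a y)^-1 of
   the positive weights have degree 0; the j - i' factors (1 - a x^-1), resp.
   the i' - j factors (1 - a x^-1)^-1, of the negative ones have minimal degree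
   -1, resp. 1, which adds i' - j in both cases. *)
Definition mindeg (R : realType) (s : {ffun segment -> R}) (i : 'I_l) : R :=
  (\sum_(r < n | colour D (rpos r) == i) - (1 / 2%:R)) +
  \sum_(c : crossing)
    (if positive c then
       (if kover c == i then (s (tl c) + s (br c) + 1) / 4%:R else 0) +
       (if kunder c == i then (3%:R * s (tr c) - s (bl c) + 1) / 4%:R else 0)
     else
       (if kunder c == i then
          - ((3%:R * s (tl c) - s (br c) + 1) / 4%:R) + (s (tl c) - s (br c))
        else 0) +
       (if kover c == i then - ((s (tr c) + s (bl c) + 1) / 4%:R) else 0)).

Definition QN (R : realType) (iota : signs) (N : nat) :
    set {ffun segment -> R} :=
  [set s | OmegaR iota s /\ \sum_i mindeg s i <= N%:R]%classic.

Definition nice (R : realType) (iota : signs) : Prop :=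
  exists N : nat,
    (exists s, QN (R := R) iota N s) /\
    (exists B : R, forall s, QN iota N s -> forall e, `|s e| <= B).

(* Steps of the multicycle of the - segments *)
Definition step_oo (iota : signs) c := ~~ iota (o_in c) && ~~ iota (o_out c).
Definition step_uu (iota : signs) c := ~~ iota (u_in c) && ~~ iota (u_out c).
Definition step_ou (iota : signs) c :=
  [&& ~~ iota (o_in c), ~~ iota (u_out c) & iota (u_in c)].

Definition cycle_step (iota : signs) (e e' : segment) : bool :=
  [exists c, [|| [&& step_oo iota c, e == o_in c & e' == o_out c],
                 [&& step_uu iota c, e == u_in c & e' == u_out c] |
                 [&& step_ou iota c, e == o_in c & e' == u_out c]]].

Definition same_cycle (iota : signs) : rel segment :=
  connect (fun e e' => cycle_step iota e e' || cycle_step iota e' e).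

(* number of cycles that do not contain the open strand *)
Definition nb_closed (iota : signs) : nat :=
  #|[set [set e' | same_cycle iota e e'] |
      e : segment & ~~ iota e && ~~ same_cycle iota e (bottom ord0)]|.

Definition xfrac (i : 'I_l) : {fraction {mpoly int[l]}} := tofrac 'X_i.

Definition W (iota : signs) : {fraction {mpoly int[l]}} :=
  \prod_(c : crossing)
    ((if step_oo iota c then
        if positive c then xfrac (kunder c) else (xfrac (kunder c))^-1
      else 1) *
     (if step_ou iota c then
        if positive c then 1 - xfrac (kover c)
        else xfrac (kover c) / xfrac (kunder c) * (1 - (xfrac (kover c))^-1)
      else 1)).

Definition W_exponents (iota : signs) (a : {ffun 'I_l -> int}) : Prop :=
  exists (sgn : bool) (b : {ffun 'I_l -> nat}),
    W iota = (-1) ^+ sgn * \prod_i (xfrac i ^ a i) *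
             \prod_i (1 - xfrac i) ^+ b i.

Definition csign (c : crossing) : rat := if positive c then 1 else -1.

(* linking number, or signed number of self-crossings when i = j *)
Definition lk (i j : 'I_l) : rat :=
  if i == j then
    \sum_(c | (kover c == i) && (kunder c == i)) csign c
  else
    (\sum_(c | ((kover c == i) && (kunder c == j)) ||
               ((kover c == j) && (kunder c == i))) csign c) / 2%:R.

Definition rho (i : 'I_l) : rat :=
  (#|[set r | colour D r == i]|%:R - \sum_j lk i j) / 2%:R.

Definition stateSum (iota : signs) : series qfield l :=
  fun k => \sum_(s \in Omega iota) P s k.

Definition F (iota : signs) : series qfield l :=
  let x1 := colour D ord0 in
  smul (fun k => smono (xe x1 (1 / 2%:R)) 1 k - smono (xe x1 (- (1 / 2%:R))) 1 k)
       (fun k => (-1) ^+ nb_closed iota * stateSum iota k).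

(* For each d, only finitely many terms of the P s (s in Omega iota) have total
   degree d; hence so do the coefficients of F, and the evaluation of F at
   x = (x, ..., x) is defined. *)
Definition diag_summable (iota : signs) : Prop :=
  forall d : rat,
    finite_set [set sk : state * expo l |
      [/\ Omega iota sk.1, tdeg sk.2 = d & P sk.1 sk.2 != 0]]%classic.

(* The Fox matrix, with abelianized entries, of the Wirtinger presentation of
   the link group.  The generators are the segments; the relations at a crossing
   are o_out = o_in, and o_in u_out = u_in o_in (positive crossing) or
   u_out o_in = o_in u_in (negative crossing). *)
Definition fox (r : crossing * bool) (e : segment) : {mpoly int[l]} :=
  let c := r.1 in
  let d e' : {mpoly int[l]} := (e == e')%:R in
  if r.2 then d (o_out c) - d (o_in c)
  else if positive c then
    (1 - 'X_(kunder c)) * d (o_in c) + 'X_(kover c) * d (u_out c) - d (u_in c)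
  else
    d (u_out c) + ('X_(kunder c) - 1) * d (o_in c) - 'X_(kover c) * d (u_in c).

Definition fox_minor (f : 'I_#|segment|.-1 -> crossing * bool)
    (g : 'I_#|segment|.-1 -> segment) : {mpoly int[l]} :=
  \det (\matrix_(i, j) fox (f i) (g j)).

Definition mdvd (a b : {mpoly int[l]}) : Prop := exists c, b = c * a.

Definition alexander_gcd (p : {mpoly int[l]}) : Prop :=
  (forall f g, mdvd p (fox_minor f g)) /\
  (forall p', (forall f g, mdvd p' (fox_minor f g)) -> mdvd p' p).

(* A generator multiplied by a monomial with half-integer exponents *)
Definition alexander_shift (A : series int l) : Prop :=
  exists2 p : {mpoly int[l]}, alexander_gcd p &
  exists c : {ffun 'I_l -> int}, forall e : expo l,
    A e = \sum_(m <- msupp p |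
                [forall i, e i == (c i)%:~R / 2%:R + (m i)%:R]) p@_m.

(* Delta_L, normalized by Delta_L(x^-1) = (-1)^l Delta_L(x).  A knot has no
   Laurent polynomial with this symmetry; the normalization is the one of the
   Conway function, Delta_K(x) / (x^{1/2} - x^{-1/2}) with Delta_K symmetric,
   which is expanded at x = 0. *)
Definition alexander (Delta : series int l) : Prop :=
  if l == 1%N then
    exists2 A : series int l, alexander_shift A & [/\
      forall e, A (- e) = A e,
      forall e, Delta (e - [ffun=> 1 / 2%:R]) - Delta (e + [ffun=> 1 / 2%:R])
                = A e &
      exists B : rat, forall e, tdeg e < B -> Delta e = 0]
  else
    alexander_shift Delta /\ forall e, Delta (- e) = (-1) ^+ l * Delta e.

End Diagram.

Section Newton.
Variables (R : realType) (l : nat).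

Definition toR (e : expo l) : 'rV[R]_l := \row_i ratr (e i).

Definition supp (A : series int l) : set (expo l) := [set e | A e != 0]%classic.

Definition conv_hull (S : set 'rV[R]_l) : set 'rV[R]_l :=
  [set p | exists (k : nat) (a : 'I_k -> R) (y : 'I_k -> 'rV[R]_l),
     [/\ forall i, 0 <= a i, \sum_i a i = 1, forall i, S (y i) &
         p = \sum_i a i *: y i]]%classic.

Definition newton (A : series int l) : set 'rV[R]_l :=
  conv_hull [set toR e | e in supp A]%classic.

(* vertices, i.e. extreme points *)
Definition vertex (N : set 'rV[R]_l) (p : 'rV[R]_l) : Prop :=
  N p /\
  forall (y z : 'rV[R]_l) (t : R), N y -> N z -> 0 < t -> t < 1 ->
    p = t *: y + (1 - t) *: z -> y = p /\ z = p.

(* (D, iota) is a nice pair with closure L and v / 2 = rho + a; the open strand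
   belongs to the first component *)
Definition presents (L : cbraid l) (v : expo l) (D : cbraid l)
    (iota : signs D) : Prop :=
  [/\ is_link D /\ same_link L D, colour D ord0 = 0 :> nat,
      inversion_datum iota, nice R iota &
      exists2 a, W_exponents iota a &
        forall i, halve v i = rho D i + (a i)%:~R].

Definition nice_pair (L : cbraid l) (v : expo l) : Prop :=
  exists (D : cbraid l) (iota : signs D), presents L v iota.

(* v in G(L), where Delta is the Alexander polynomial of L *)
Definition GG (L : cbraid l) (Delta : series int l) (v : expo l) : Prop :=
  vertex (newton Delta) (toR (halve v)) /\ nice_pair L v.

End Newton.

Definition unique_minimizer (l : nat) (Delta : series int l) (v : expo l) :
    Prop :=
  forall e, supp Delta e -> e != halve v -> tdeg (halve v) < tdeg e.

(* Main.v *)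
(* On a state s the minimal total degree of P s is, up to a constant, half of
   height s, the sum of +-(j + j') over the crossings.  The states are integral
   points of a translate, with apex the ground state, of a rational polyhedral
   cone.  Along any u in this cone the real relaxation contains a half-line, so
   niceness forces height u > 0 for u <> 0.  Hence the ground state is the
   unique minimizer, and by Dickson's lemma only finitely many terms have a
   given total degree.  The degree of the ground state is compared with v
   through the order at x = 0 of the weight W at (x, ..., x).  The conservation
   law at the crossings makes the sum of j' - j vanish, which gives the
   integrality of the relative degrees and the parity of the powers of
   q^{1/2}. *)

Require Import Defs.
From mathcomp Require Import all_boot all_order all_algebra all_fingroup.
From mathcomp Require Import ring lra zify.
From mathcomp Require Import mpoly.
From mathcomp Require Import boolp classical_sets functions cardinality.
From mathcomp Require Import fsbigop reals.
Import Order.TTheory GRing.Theory Num.Theory.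
Local Open Scope ring_scope.

Set Implicit Arguments.
Unset Strict Implicit.
Unset Printing Implicit Defensive.

(** An infinite support is harmless: the sum is then 0 by convention, which [S 0] covers. Hence the
    integrality of products and evaluations is proved without reference to summability. *)
Lemma fsum_closed (K : nmodType) (T : choiceType) (A : set T) (f : T -> K)
    (S : K -> Prop) :
  S 0 -> (forall x y, S x -> S y -> S (x + y)) -> (forall i, A i -> S (f i)) ->
  S (\sum_(i \in A) f i).
Proof.
move=> S0 SD Sf; rewrite big_seq_cond; apply: (big_ind S) => // i.
rewrite andbT; case: finite_supportP => [//|X XA _ _ iX].
exact/Sf/XA.
Qed.

Lemma fsum_neq0 (K : nmodType) (T : choiceType) (A : set T) (f : T -> K) :
  \sum_(i \in A) f i != 0 -> exists2 i, A i & f i != 0.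
Proof.
move=> nz; apply: contrapT => H; move/eqP: nz; apply; apply: fsbig1 => i Ai.
by apply/eqP; apply: contrapT => /negP fi; apply: H; exists i.
Qed.

(** * Coefficients *)

(* laurent q is in_Zq.  The base field is kept abstract because unification at
   qfield unfolds the construction of the field of fractions and hardly
   terminates. *)
Section LaurentCoefficients.
Variables (K : fieldType) (u : K).
Hypothesis u_neq0 : u != 0.

Definition laurent (a : K) : Prop :=
  exists (p : {poly int}) (N : nat),
    a = (map_poly (fun z : int => z%:~R) p).[u] / u ^+ N.

Lemma laurentC (z : int) : laurent z%:~R.
Proof. by exists z%:P, 0%N; rewrite map_polyC hornerC expr0 divr1. Qed.

Lemma laurentD a b : laurent a -> laurent b -> laurent (a + b).
Proof.
move=> [p [M ->]] [p' [N ->]]; exists (p * 'X^N + p' * 'X^M), (M + N)%N.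
rewrite rmorphD !rmorphM /= !map_polyXn hornerD !hornerM !hornerXn exprD.
by rewrite addf_div ?expf_neq0.
Qed.

Lemma laurentM a b : laurent a -> laurent b -> laurent (a * b).
Proof.
move=> [p [M ->]] [p' [N ->]]; exists (p * p'), (M + N)%N.
by rewrite rmorphM /= hornerM mulf_div exprD.
Qed.

Lemma laurent0 : laurent 0. Proof. exact: (laurentC 0). Qed.
Lemma laurent1 : laurent 1. Proof. exact: (laurentC 1). Qed.

Lemma laurentN a : laurent a -> laurent (- a).
Proof. by rewrite -mulN1r; apply: laurentM; apply: (laurentC (-1)). Qed.

Lemma laurentB a b : laurent a -> laurent b -> laurent (a - b).
Proof. by move=> ha hb; apply: laurentD ha (laurentN hb). Qed.

Lemma laurentz (z : int) : laurent (u ^ z).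
Proof.
case: z => n.
  by exists 'X^n, 0%N; rewrite map_polyXn hornerXn expr0 divr1.
by exists 1, n.+1; rewrite rmorph1 hornerC div1r NegzE.
Qed.

Lemma laurentX a n : laurent a -> laurent (a ^+ n).
Proof.
move=> la; elim: n => [|n IH]; first by rewrite expr0; exact: laurent1.
by rewrite exprS; apply: laurentM.
Qed.

End LaurentCoefficients.

(** * Gaussian binomials with an integer upper index *)

Section GaussianBinomial.
Variables (K : fieldType) (v u : K).
Hypothesis u_laurent : forall z : int, laurent v (u ^ z).
Hypothesis v_neq0 : v != 0.
Hypothesis u_neq0 : u != 0.
Hypothesis uX_neq1 : forall n, u ^+ n.+1 != 1.

Let poch (a b : K) (k : nat) := \prod_(r < k) (1 - a * b ^+ r).
Let binom (m : int) (k : nat) := poch (u ^ m) u^-1 k / poch u u k.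

Let poch_neq0 k : poch u u k != 0.
Proof.
by apply/prodf_neq0 => r _; rewrite -exprS subr_eq0 eq_sym uX_neq1.
Qed.

(** Pascal's rule, valid for negative [m] as well. *)
Let binomS (m : int) k :
  binom (m + 1) k.+1 = u ^+ k.+1 * binom m k.+1 + binom m k.
Proof.
have E : poch (u ^ (m + 1)) u^-1 k.+1 = (1 - u ^ m * u) * poch (u ^ m) u^-1 k.
  rewrite /poch big_ord_recl expr0 mulr1 expfzDr // expr1z; congr (_ * _).
  apply: eq_bigr => r _ /=; congr (1 - _).
  by rewrite /bump /= add1n exprS mulrA mulfK.
have Em : poch (u ^ m) u^-1 k.+1 =
    poch (u ^ m) u^-1 k * (1 - u ^ m * u^-1 ^+ k).
  by rewrite /poch big_ord_recr.
have Eu : poch u u k.+1 = poch u u k * (1 - u ^+ k.+1).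
  by rewrite /poch big_ord_recr /= exprS.
rewrite /binom E Em Eu; have := poch_neq0 k.
have hk : 1 - u ^+ k.+1 != 0 by rewrite subr_eq0 eq_sym uX_neq1.
have hu : u ^+ k != 0 by rewrite expf_neq0.
move: hk hu; rewrite exprVn exprS.
move: (u ^+ k) (u ^ m) (poch u u k) (poch _ _ k) => a b c d hk ha hc.
by field; rewrite hc hk.
Qed.

Let binom0S k : binom 0 k.+1 = 0.
Proof. by rewrite /binom /poch big_ord_recl /= mul1r expr0 subrr !mul0r. Qed.

(** Induction on [k], then on [m] away from 0 in both directions: Pascal's rule is read upwards for
    positive [m] and solved for the entry with the smaller upper index for negative [m]. Keeping [v]
    apart from [u] covers both [u = v] and [u = v^-1]. *)
Lemma laurent_gauss_binomial (m : int) k :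
  laurent v ((\prod_(r < k) (1 - u ^ m * u^-1 ^+ r)) /
             (\prod_(r < k) (1 - u * u ^+ r))).
Proof.
rewrite -[X in laurent _ X]/(binom m k); elim: k m => [m|k IH m].
  by rewrite /binom /poch !big_ord0 divr1; exact: laurent1.
have uk : laurent v (u ^+ k.+1) := u_laurent k.+1.
have ukV : laurent v (u ^+ k.+1)^-1 := u_laurent (- k.+1%:Z).
elim: m => [|m IHm|m IHm].
- by rewrite binom0S; exact: laurent0.
- by rewrite -addn1 PoszD binomS; apply: laurentD => //; apply: laurentM.
- have := binomS (- m.+1%:Z) k.
  have -> : - m.+1%:Z + 1 = - m%:Z :> int by lia.
  move=> E; have -> : binom (- m.+1%:Z) k.+1 =
      (u ^+ k.+1)^-1 * (binom (- m%:Z) k.+1 - binom (- m.+1%:Z) k).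
    by rewrite E addrK mulKf // expf_neq0.
  by apply: laurentM => //; apply: laurentB.
Qed.

End GaussianBinomial.

Lemma laurent_gauss_binomialV (K : fieldType) (u : K) :
  u != 0 -> (forall n, u ^+ n.+1 != 1) -> forall (m : int) k,
  laurent u ((\prod_(r < k) (1 - u^-1 ^ m * u^-1^-1 ^+ r)) /
             (\prod_(r < k) (1 - u^-1 * u^-1 ^+ r))).
Proof.
move=> u0 u1; apply: laurent_gauss_binomial => [z|//||n].
- by rewrite exprz_inv; apply: laurentz.
- by rewrite invr_eq0.
- by rewrite exprVn invr_eq1.
Qed.

Lemma qh_neq0 : qh != 0.
Proof. by rewrite tofrac_eq0 polyX_eq0. Qed.

Lemma q_neq0 : q != 0.
Proof. exact: expf_neq0 _ qh_neq0. Qed.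

Lemma qX_neq1 n : q ^+ n.+1 != 1.
Proof.
rewrite /q /qh -exprM -tofracXn -tofrac1 tofrac_eq; apply/eqP.
by move/(congr1 (fun p : {poly int} => size p)); rewrite size_polyXn size_poly1.
Qed.

Lemma laurent_qbinom_q m k : laurent q (qbinom q m k).
Proof.
exact: laurent_gauss_binomial (laurentz _) q_neq0 q_neq0 qX_neq1 m k.
Qed.

Lemma laurent_qbinom_qV m k : laurent q (qbinom q^-1 m k).
Proof. exact: laurent_gauss_binomialV q_neq0 qX_neq1 m k. Qed.

(** * Series supported in a translate of N^l *)

Lemma xeD (l : nat) (i : 'I_l) r t : xe i (r + t) = xe i r + xe i t.
Proof. by apply/ffunP => j; rewrite !ffunE; case: eqP; rewrite ?addr0. Qed.

Section GradedSeries.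
Variables (K : fieldType) (h : K) (l : nat).
Hypothesis h_neq0 : h != 0.

(* Used implicitly: [exact] finds it as the side condition of laurentD. *)
Let h2_neq0 : h ^+ 2 != 0.
Proof. exact: expf_neq0. Qed.

(* hlaurent qh l.-1 is in_shifted_Zq l. *)
Definition hlaurent (z : int) (a : K) : Prop :=
  exists2 c, laurent (h ^+ 2) c & a = h ^ z * c.

(** The exponent [e] bounds the support from below and need not be attained. Support and
    coefficients are tracked together, so that one pass through the products defining [P] gives both
    degrees and integrality. *)
Definition graded (e : expo l) (z : int) (f : series K l) : Prop :=
  forall k,
    (f k != 0 ->
     exists n : {ffun 'I_l -> nat}, forall i, k i = e i + (n i)%:R) /\
    hlaurent z (f k).

Lemma hlaurent0 z : hlaurent z 0.
Proof. by exists 0; [exact: laurent0|rewrite mulr0]. Qed.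

Lemma hlaurentD z a b : hlaurent z a -> hlaurent z b -> hlaurent z (a + b).
Proof.
move=> [c lc ->] [d ld ->]; exists (c + d); last by rewrite mulrDr.
exact: laurentD.
Qed.

Lemma hlaurent_sum z (T : choiceType) (A : set T) (f : T -> K) :
  (forall i, A i -> hlaurent z (f i)) -> hlaurent z (\sum_(i \in A) f i).
Proof.
by apply: fsum_closed => [|x y]; [exact: hlaurent0|exact: hlaurentD].
Qed.

Lemma graded0 e z : graded e z (fun=> 0).
Proof. by move=> k /=; split; [rewrite eqxx|exact: hlaurent0]. Qed.

Lemma graded_mono e z c :
  laurent (h ^+ 2) c -> graded e z (smono e (h ^ z * c)).
Proof.
move=> lc k; rewrite /smono; case: (eqVneq k e) => [->|_]; last first.
  by split; [rewrite eqxx|exact: hlaurent0].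
split; last by exists c.
by move=> _; exists [ffun=> 0%N] => i; rewrite ffunE addr0.
Qed.

Lemma graded_mono1 e : graded e 0 (smono e 1).
Proof.
rewrite -[1](mulr1 (h ^ 0)); exact: graded_mono (laurent1 _).
Qed.

Lemma graded_one : graded 0 0 (@sone K l).
Proof. exact: graded_mono1. Qed.

Lemma graded_mul e z f e' z' f' :
  graded e z f -> graded e' z' f' -> graded (e + e') (z + z') (smul f f').
Proof.
move=> Hf Hf' k; split.
  move=> /fsum_neq0[m _]; rewrite mulf_eq0 negb_or => /andP[fm fk].
  have [n En] := (Hf m).1 fm; have [n' En'] := (Hf' _).1 fk.
  exists [ffun i => n i + n' i]%N => i; have := En' i.
  rewrite !ffunE natrD => E; rewrite -[k i](subrK (m i)) E En; lra.
apply: hlaurent_sum => m _; have [c lc ->] := (Hf m).2.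
have [d ld ->] := (Hf' (k - m)).2.
by exists (c * d); [exact: laurentM|rewrite mulrACA -expfzDr].
Qed.

Lemma graded_big (I : Type) (r : seq I) (A : pred I) e z f :
  (forall i, graded (e i) (z i) (f i)) ->
  graded (\sum_(i <- r | A i) e i) (\sum_(i <- r | A i) z i)
         (\big[@smul K l/@sone K l]_(i <- r | A i) f i).
Proof.
move=> H; apply: (big_rec3 (fun e z f => graded e z f)).
  exact: graded_one.
by move=> i e' z' f' _; apply: graded_mul.
Qed.

Lemma gradedB e z f g :
  graded e z f -> graded e z g -> graded e z (fun k => f k - g k).
Proof.
move=> Hf Hg k; split; last first.
  apply: hlaurentD (Hf k).2 _; have [c lc ->] := (Hg k).2.
  by exists (- c); [exact: laurentN|rewrite mulrN].
case: (eqVneq (f k) 0) => [->|fk _]; last exact: (Hf k).1.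
by rewrite sub0r oppr_eq0; apply: (Hg k).1.
Qed.

Lemma graded_shift (e e' : expo l) z f (n : 'I_l -> nat) :
  graded e z f -> (forall i, e i = e' i + (n i)%:R) -> graded e' z f.
Proof.
move=> Hf En k; split; last exact: (Hf k).2.
move=> /((Hf k).1)[n' En']; exists [ffun i => n i + n' i]%N => i.
by rewrite En' En ffunE natrD addrA.
Qed.

Lemma graded_smono_xe (i : 'I_l) (t : nat) a :
  laurent (h ^+ 2) a -> graded 0 0 (smono (xe i t%:R) a).
Proof.
move=> la; rewrite -[a]mul1r.
apply: (graded_shift (n := fun j => if j == i then t else 0%N)).
  exact: (graded_mono (xe i t%:R) 0 la).
by move=> j; rewrite !ffunE add0r; case: ifP.
Qed.

Lemma graded_binom (i : 'I_l) a :
  laurent (h ^+ 2) a -> graded 0 0 (sbinom i 1 a).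
Proof.
by move=> la; apply: gradedB; [exact: graded_one|exact: (graded_smono_xe i 1)].
Qed.

Lemma graded_binomV (i : 'I_l) a :
  laurent (h ^+ 2) a -> graded (xe i (-1)) 0 (sbinom i (-1) a).
Proof.
move=> la; apply: gradedB; last first.
  by rewrite -[a]mul1r; exact: (graded_mono (xe i (-1)) 0 la).
apply: (graded_shift (n := fun j => (j == i) : nat) graded_one) => j.
by rewrite !ffunE; case: eqP => _ /=; rewrite ?addNr ?addr0.
Qed.

Lemma graded_geom (i : 'I_l) a :
  laurent (h ^+ 2) a -> graded 0 0 (sgeom i a).
Proof.
move=> la k; have Ht t := graded_smono_xe i t (laurentX t la) k.
split; first by move=> /fsum_neq0[t _]; exact: (Ht t).1.
by apply: hlaurent_sum => t _; exact: (Ht t).2.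
Qed.

(** The expansion at 0 starts with x_i and involves only powers of [a^-1]; hence the exponent 1 and
    the hypothesis on [a^-1]. *)
Lemma graded_geomV (i : 'I_l) a :
  laurent (h ^+ 2) a^-1 -> graded (xe i 1) 0 (sgeomV i a).
Proof.
move=> la; rewrite -[xe i 1]addr0 -[0 : int]addr0.
apply: graded_mul (graded_geom _ la).
rewrite -[- a^-1]mul1r; exact: (graded_mono (xe i 1) 0 (laurentN la)).
Qed.

Lemma graded_prod1 (I : Type) (r : seq I) f :
  (forall i, graded 0 0 (f i)) ->
  graded 0 0 (\big[@smul K l/@sone K l]_(i <- r) f i).
Proof.
move=> Hf; have := graded_big r predT (e := fun=> 0) (z := fun=> 0) Hf.
by rewrite !big1_eq.
Qed.

Lemma graded_prod_xe (i : 'I_l) t (a b : nat) f :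
  (forall r, graded (xe i t) 0 (f r)) ->
  graded (xe i (t * (b - a)%:R)) 0 (\big[@smul K l/@sone K l]_(a <= r < b) f r).
Proof.
move=> Hf.
have := graded_big (index_iota a b) predT (e := fun=> xe i t) (z := fun=> 0) Hf.
rewrite big1_eq sumr_const_nat; congr graded; apply/ffunP => j.
by rewrite ffunMnE !ffunE; case: eqP => _; rewrite ?mul0rn // mulr_natr.
Qed.

End GradedSeries.

(** * Lower exponents and powers of q^{1/2} of the crossing weights *)

Section CrossingWeights.
Variables (l : nat) (x y : 'I_l) (i j i' j' : int).

Definition Rpos_expo : expo l :=
  xe x ((i' + j + 1)%:~R / 4%:R) + xe y ((3 * j' - i + 1)%:~R / 4%:R).

(** The summand [i' - j] is the contribution of the factors 1 - a x^-1 or of their inverses. *)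
Definition Rneg_expo : expo l :=
  xe x (- ((3 * i' - j + 1)%:~R / 4%:R) + (i' - j)%:~R) +
  xe y (- ((j' + i + 1)%:~R / 4%:R)).

Lemma graded_Rpos :
  graded qh Rpos_expo (j + j' + 1 + 2 * (j * j')) (Rpos x y i j i' j').
Proof.
have pre k := graded_mono (h := qh) Rpos_expo
  (j + j' + 1 + 2 * (j * j')) (laurent_qbinom_q i k).
rewrite /Rpos; case: ifP => _; last case: ifP => _; last exact: graded0.
- rewrite -[Rpos_expo]addr0 -[X in graded _ _ X]addr0.
  apply: (graded_mul qh_neq0 (pre _)); apply: (graded_prod1 qh_neq0) => r.
  apply: (graded_binom qh_neq0); exact: (laurentz q).
- rewrite -[Rpos_expo]addr0 -[X in graded _ _ X]addr0.
  apply: (graded_mul qh_neq0 (pre _)); apply: (graded_prod1 qh_neq0) => r.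
  apply: (graded_geom qh_neq0); exact: (laurentz q).
Qed.

Lemma graded_Rneg :
  graded qh Rneg_expo (- (i + i' + 1 + 2 * (i * i'))) (Rneg x y i j i' j').
Proof.
pose e : expo l := xe x (- ((3 * i' - j + 1)%:~R / 4%:R)) +
     xe y (- ((j' + i + 1)%:~R / 4%:R)).
have Ee : Rneg_expo = e + xe x (i' - j)%:~R.
  by rewrite /e /Rneg_expo xeD addrAC.
have pre k := graded_mono (h := qh) e
  (- (i + i' + 1 + 2 * (i * i'))) (laurent_qbinom_qV j k).
rewrite /Rneg Ee -[X in graded _ _ X]addr0.
case: ifP => H1; last case: ifP => H2; last exact: graded0.
- apply: (graded_mul qh_neq0 (pre _)).
  (* There are [j - i'] factors of lowest exponent -1; the case hypothesis ensures [i' <= j]. *)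
  have -> : (i' - j)%:~R = -1 * (`|j - i'|.+1 - 1)%N%:R :> rat.
    rewrite subn1 /= mulN1r; rewrite pmulrn -mulrNz; congr (_%:~R); lia.
  apply: (graded_prod_xe qh_neq0) => r.
  apply: (graded_binomV qh_neq0); exact: (laurentz q).
- apply: (graded_mul qh_neq0 (pre _)).
  have -> : (i' - j)%:~R = 1 * (`|i' - j| - 0)%N%:R :> rat.
    rewrite subn0 mul1r; rewrite pmulrn; congr (_%:~R); lia.
  apply: (graded_prod_xe qh_neq0) => r.
  apply: (graded_geomV qh_neq0).
  by rewrite invr_expz; exact: (laurentz q).
Qed.

End CrossingWeights.

Section State.
Variables (l : nat) (D : cbraid l).
Local Notation n := (width D).
Local Notation m := (size (letters D)).

Definition crossing_expo (s : state D) (c : crossing D) : expo l :=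
  if positive c
  then Rpos_expo (kover c) (kunder c)
         (s (bl c)) (s (br c)) (s (tl c)) (s (tr c))
  else Rneg_expo (kunder c) (kover c)
         (s (bl c)) (s (br c)) (s (tl c)) (s (tr c)).

Definition crossing_qexpo (s : state D) (c : crossing D) : int :=
  if positive c
  then s (br c) + s (tr c) + 1 + 2 * (s (br c) * s (tr c))
  else - (s (bl c) + s (tl c) + 1 + 2 * (s (bl c) * s (tl c))).

Definition state_expo (s : state D) : expo l :=
  \sum_(r < n) xe (colour D (rpos r)) (- (1 / 2%:R)) +
  \sum_(c : crossing D) crossing_expo s c.

Definition state_qexpo (s : state D) : int :=
  \sum_(r < n) (- 1 - 2 * s (bottom (rpos r))) +
  \sum_(c : crossing D) crossing_qexpo s c.

Lemma graded_P (s : state D) : graded qh (state_expo s) (state_qexpo s) (P s).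
Proof.
apply: (graded_mul qh_neq0).
  apply: (graded_big qh_neq0) => r.
  rewrite -[qh ^ _]mulr1; exact: (graded_mono _ _ (laurent1 _)).
apply: (graded_big qh_neq0) => c.
rewrite /Rweight /crossing_expo /crossing_qexpo.
by case: ifP => _; [exact: graded_Rpos|exact: graded_Rneg].
Qed.

End State.

(** * The conservation law along the braid *)

Section Diagram.
Variables (l : nat) (D : cbraid l).
Local Notation n := (width D).
Local Notation m := (size (letters D)).

Lemma seg_step (p p' : Defs.point D) : point_step p p' -> seg p = seg p'.
Proof.
move=> pp'; apply: val_inj; apply/setP => z; rewrite !inE /same_segment.
apply: same_connect; last by apply: connect1; rewrite pp'.
by apply: sym_connect_sym => a b; rewrite orbC.
Qed.

Lemma seg_pass (c : crossing D) r :
  r != lpos (letter c).1 -> r != rpos (letter c).1 ->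
  seg (widen_ord (leqnSn m) c, r) = seg (lift ord0 c, r) :> segment D.
Proof.
move=> rl rr; apply: seg_step; rewrite /point_step eqxx /=; apply/orP; left.
by apply/existsP; exists c; rewrite !eqxx rl rr.
Qed.

Lemma seg_close r : seg (ord_max, r) = seg (ord0, r) :> segment D.
Proof. by apply: seg_step; rewrite /point_step !eqxx orbT. Qed.

Lemma lpos_neq_rpos (i : 'I_n) : lpos i != rpos i.
Proof. by rewrite -val_eqE /= /bump /= add1n neq_ltn ltnSn. Qed.

Definition conserved (V : comNzRingType) (s : segment D -> V) : Prop :=
  forall c, s (bl c) + s (br c) = s (tl c) + s (tr c).

(** The crossing positions have weights p and p + 1 and their total label is preserved, so p times
    the change cancels and one copy of the change on the right remains. *)
Lemma weighted_sum_step (V : comNzRingType) (f g : 'I_n.+1 -> V) (i : 'I_n) :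
  (forall r, r != lpos i -> r != rpos i -> f r = g r) ->
  f (lpos i) + f (rpos i) = g (lpos i) + g (rpos i) ->
  \sum_(r < n.+1) r%:R * g r - \sum_(r < n.+1) r%:R * f r =
  g (rpos i) - f (rpos i).
Proof.
move=> fg E; have nlr := lpos_neq_rpos i.
rewrite -sumrB (bigD1 (lpos i)) //= (bigD1 (rpos i)) //=; last first.
  by rewrite eq_sym.
rewrite big1 => [|r /andP[rl rr]]; last by rewrite fg // subrr.
rewrite /bump /= add1n mulrS.
have -> : g (lpos i) = f (lpos i) + f (rpos i) - g (rpos i) by rewrite E addrK.
ring.
Qed.

(* The sum over the positions r of r times the label at position r changes by
   j' - j across a crossing, and takes the same value at the bottom and at the
   top. *)
Lemma sum_right_labels (V : comNzRingType) (s : segment D -> V) :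
  conserved s -> \sum_c s (tr c) = \sum_c s (br c).
Proof.
move=> Hs; pose Phi (t : 'I_m.+1) := \sum_(r < n.+1) r%:R * s (seg (t, r)).
have step c :
    Phi (lift ord0 c) - Phi (widen_ord (leqnSn m) c) = s (tr c) - s (br c).
  apply: (weighted_sum_step (f := fun r => s (seg (widen_ord (leqnSn m) c, r)))
    (g := fun r => s (seg (lift ord0 c, r))) _ (Hs c)) => r rl rr.
  by congr s; exact: seg_pass.
apply/eqP; rewrite -subr_eq0 -sumrB -(eq_bigr _ (fun c _ => step c)) sumrB.
(* Telescoping: the same sum is split once at its first and once at its last level, whose values
   agree. *)
have E : \sum_t Phi t = \sum_t Phi t by [].
rewrite {1}big_ord_recl big_ord_recr /= in E.
have Phi0 : Phi ord0 = Phi ord_max.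
  by apply: eq_bigr => r _; congr (_ * s _); rewrite seg_close.
by move: E; rewrite [RHS]addrC Phi0 => /addrI ->; rewrite subrr.
Qed.

End Diagram.

(** * Total degrees and parity *)

Lemma tdegD (l : nat) (e e' : expo l) : tdeg (e + e') = tdeg e + tdeg e'.
Proof. by rewrite /tdeg -big_split; apply: eq_bigr => i _; rewrite ffunE. Qed.

Lemma tdeg_xe (l : nat) (i : 'I_l) r : tdeg (xe i r) = r.
Proof.
rewrite /tdeg (bigD1 i) //= ffunE eqxx big1 ?addr0 // => j ji.
by rewrite ffunE (negbTE ji).
Qed.

Lemma tdeg_sum (l : nat) (I : Type) (r : seq I) (e : I -> expo l) :
  tdeg (\sum_(i <- r) e i) = \sum_(i <- r) tdeg (e i).
Proof.
apply: (big_morph (@tdeg l)); first exact: tdegD.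
by rewrite /tdeg big1 // => i _; rewrite ffunE.
Qed.

Section Degrees.
Variables (l : nat) (D : cbraid l).
Local Notation n := (width D).
Local Notation m := (size (letters D)).

Definition signed (V : zmodType) (c : crossing D) (a : V) : V :=
  if positive c then a else - a.

Definition height (V : comNzRingType) (s : segment D -> V) : V :=
  \sum_(c : crossing D) signed c (s (br c) + s (tr c)).

Definition writhe (V : comNzRingType) : V := \sum_(c : crossing D) signed c 1.

Lemma height_lin (V : comNzRingType) (s u : segment D -> V) t :
  height (fun e => s e + t * u e) = height s + t * height u.
Proof.
rewrite /height mulr_sumr -big_split; apply: eq_bigr => c _ /=.
by rewrite /signed; case: ifP => _; ring.
Qed.

Lemma height_intr (V : comNzRingType) (s : segment D -> int) :
  height (fun e => (s e)%:~R) = (height s)%:~R :> V.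
Proof.
rewrite /height rmorph_sum; apply: eq_bigr => c _ /=.
by rewrite /signed; case: ifP => _; rewrite ?rmorphN rmorphD.
Qed.

(** Subtracting the vanishing sum of j' - j leaves 2j at a positive crossing and -2j' at a negative
    one. *)
Lemma height_even (s : segment D -> int) :
  conserved s -> exists z : int, height s = 2 * z.
Proof.
move=> Hs; exists (\sum_c (if positive c then s (br c) else - s (tr c))).
have E : \sum_c (s (tr c) - s (br c)) = 0.
  by rewrite sumrB sum_right_labels // subrr.
apply: etrans (_ : height s - \sum_c (s (tr c) - s (br c)) = _).
  by rewrite E subr0.
rewrite -sumrB mulr_sumr; apply: eq_bigr => c _.
by rewrite /signed; case: ifP => _; ring.
Qed.

(** Once i is eliminated by conservation, a crossing contributes (j + j' + 1) / 2 up to its sign. *)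
Lemma tdeg_state_expo (s : state D) :
  conserved s ->
  tdeg (state_expo s) = (writhe rat - n%:R + (height s)%:~R) / 2%:R.
Proof.
move=> Hs; rewrite tdegD !tdeg_sum.
under eq_bigr do rewrite tdeg_xe.
rewrite sumr_const card_ord -mulr_natr.
have -> : \sum_c tdeg (crossing_expo s c) =
    \sum_c (signed c 1 + signed c (s (br c) + s (tr c))%:~R) / 2%:R :> rat.
  apply: eq_bigr => c _; rewrite /crossing_expo /signed.
  have := Hs c.
  move: (s (bl c)) (s (br c)) (s (tl c)) (s (tr c)) => i j i' j' E.
  have -> : i = i' + j' - j by rewrite -E addrK.
  by case: ifP => _; rewrite tdegD !tdeg_xe; field.
rewrite -mulr_suml big_split /= -/(writhe rat) /height.
have -> : \sum_c signed c (s (br c) + s (tr c))%:~R = (height s)%:~R :> rat.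
  rewrite rmorph_sum; apply: eq_bigr => c _ /=.
  by rewrite /signed; case: ifP; rewrite ?rmorphN.
by field.
Qed.

(** The same computation for real labels: [QN] amounts to an upper bound on [height]. *)
Lemma sum_mindeg (R : realType) (s : {ffun segment D -> R}) :
  conserved s -> \sum_i mindeg s i = (writhe R - n%:R + height s) / 2%:R.
Proof.
move=> Hs; have pick (V : nmodType) (k : 'I_l) (a : V) :
    \sum_i (if k == i then a else 0) = a.
  by rewrite -big_mkcond (big_pred1 k) // => i; rewrite /= eq_sym.
rewrite big_split /=.
have -> : \sum_i \sum_(r < n | colour D (rpos r) == i) - (1 / 2%:R) =
    - n%:R / 2%:R :> R.
  under eq_bigr do rewrite big_mkcond; rewrite exchange_big /=.
  under eq_bigr do rewrite pick; rewrite sumr_const card_ord -mulr_natr.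
  by field.
rewrite exchange_big /=.
have -> : \sum_(c : crossing D) \sum_i
    (if positive c then
       (if kover c == i then (s (tl c) + s (br c) + 1) / 4%:R else 0) +
       (if kunder c == i then (3%:R * s (tr c) - s (bl c) + 1) / 4%:R else 0)
     else
       (if kunder c == i then
          - ((3%:R * s (tl c) - s (br c) + 1) / 4%:R) + (s (tl c) - s (br c))
        else 0) +
       (if kover c == i then - ((s (tr c) + s (bl c) + 1) / 4%:R) else 0)) =
    \sum_c (signed c 1 + signed c (s (br c) + s (tr c))) / 2%:R :> R.
  apply: eq_bigr => c _; rewrite /signed.
  have := Hs c.
  move: (s (bl c)) (s (br c)) (s (tl c)) (s (tr c)) => i j i' j' E.
  have -> : i = i' + j' - j by rewrite -E addrK.
  by case: ifP => _; rewrite big_split /= !pick; field.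
rewrite -mulr_suml big_split /= -/(writhe R) -/(height s).
by field.
Qed.

(* The closing permutation is a product of one transposition per crossing, and
   has one orbit per component. *)
Lemma odd_crossings : is_link D -> odd m = odd n.+1 (+) odd l.
Proof.
move=> [col_onto col_orbit].
have -> : odd m = odd_perm (bperm (letters D)).
  rewrite /bperm; elim: (letters D) => [|c w IH].
    by rewrite big_nil odd_perm1.
  by rewrite big_cons odd_mul_tperm lpos_neq_rpos -IH.
rewrite /odd_perm card_ord; congr (_ (+) odd _).
pose p r := porbit (bperm (letters D)) r.
have [g gK] : exists g : 'I_l -> 'I_n.+1, forall i, colour D (g i) = i.
  by exists (fun i => projT1 (cid (col_onto i))) => i; case: (cid (col_onto i)).
have p_eq r r' : (p r == p r') = (colour D r == colour D r').
  rewrite /p eq_porbit_mem; apply/idP/eqP => [/col_orbit->//|E].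
  by apply/(col_orbit r' r).
rewrite -[RHS]card_ord -(card_imset 'I_l (f := p \o g)); last first.
  by move=> i j /eqP; rewrite /= p_eq !gK => /eqP.
congr #|pred_of_set _|; apply/setP => A.
apply/imsetP/imsetP => [[r _ ->]|[i _ ->]].
  by exists (colour D r) => //; apply/eqP; rewrite /= p_eq gK.
by exists (g i).
Qed.

(** Modulo 2, each crossing contributes 1 + (j' - j) and each closed strand 1. As the sum of j' - j
    vanishes, the total has the parity of [n + m], which is that of [l.-1] by [odd_crossings]. *)
Lemma state_qexpo_parity (s : state D) :
  is_link D -> conserved s -> exists z : int, state_qexpo s = l.-1%:Z + 2 * z.
Proof.
move=> HD Hs; have odd_m := odd_crossings HD.
have l_gt0 : (0 < l)%N by apply: leq_ltn_trans (ltn_ord (colour D ord0)).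
have [z Ez] : exists z : int, (n + m)%:Z = l.-1%:Z + 2 * z.
  exists (((n + m)%:Z - l.-1%:Z) %/ 2)%Z.
  have : odd (n + m) = odd l.-1.
    have El : odd l = ~~ odd l.-1 by rewrite -[in LHS](prednK l_gt0).
    by rewrite oddD odd_m El /=; case: odd; case: odd.
  lia.
pose w c : int := if positive c then s (br c) + s (br c) * s (tr c)
  else - (s (tl c) + s (bl c) * s (tl c)) - 1 - (s (tr c) - s (br c)).
have Ec c : crossing_qexpo s c = 1 + (s (tr c) - s (br c)) + 2 * w c.
  rewrite /crossing_qexpo /w; have := Hs c.
  move: (s (bl c)) (s (br c)) (s (tl c)) (s (tr c)) => i j i' j' E.
  have -> : i = i' + j' - j by rewrite -E addrK.
  by case: ifP => _; ring.
exists (z + \sum_c w c + \sum_(r < n) (- 1 - s (bottom (rpos r)))).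
have -> : state_qexpo s = \sum_(r < n) (- 1 - 2 * s (bottom (rpos r))) +
    (m%:Z + 2 * \sum_c w c).
  congr (_ + _); rewrite (eq_bigr _ (fun c _ => Ec c)) big_split /= mulr_sumr.
  congr (_ + _); rewrite big_split sumrB /= sum_right_labels // subrr addr0.
  by rewrite sumr_const card_ord -natz.
have -> : \sum_(r < n) (- 1 - 2 * s (bottom (rpos r))) =
    n%:Z + 2 * (\sum_(r < n) (- 1 - s (bottom (rpos r)))).
  rewrite mulr_sumr -[X in X%:Z](card_ord n) -[X in X + _]natz -sumr_const.
  by rewrite -big_split; apply: eq_bigr => r _ /=; ring.
rewrite !mulrDr !addrA -Ez PoszD; ring.
Qed.

End Degrees.

(** * Finiteness *)

(** [p n] is an index from [n] on where [f] takes its least value on that range; [g] repeats this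
    choice, each time strictly beyond the previous index. *)
Lemma nondecreasing_subseq (f : nat -> nat) : exists g : nat -> nat,
  {homo g : a b / (a < b)%N} /\ {homo f \o g : a b / (a <= b)%N}.
Proof.
have /choice[p Hp] : forall n, exists k, (n <= k)%N /\
    forall k', (n <= k')%N -> (f k <= f k')%N.
  move=> n; have ex : exists v, `[< exists2 k, (n <= k)%N & f k = v >].
    by exists (f n); apply/asboolP; exists n.
  case: (ex_minnP ex) => v /asboolP[k nk <-] fmin.
  by exists k; split=> // k' nk'; apply: fmin; apply/asboolP; exists k'.
pose g k := iter k (fun x => p x.+1) (p 0%N).
have gS k : (g k < g k.+1)%N by exact: (Hp _).1.
have fmin k k' : (g k <= k')%N -> (f (g k) <= f k')%N.
  case: k => [|k] kk'; first exact: (Hp _).2.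
  by apply: (Hp _).2; apply: leq_trans kk'; exact: (Hp _).1.
exists g; split; first exact: (homo_ltn ltn_trans).
by apply: (homo_leq leqnn leq_trans) => k; apply: fmin; exact: ltnW.
Qed.

(** Dickson's lemma: subsequences are extracted for one coordinate after the other, and the first
    two terms of the last one are compared. *)
Lemma dickson (I : finType) (f : nat -> I -> nat) :
  exists a b, (a < b)%N /\ forall i, (f a i <= f b i)%N.
Proof.
have [g [g_lt Hg]] : exists g : nat -> nat, {homo g : a b / (a < b)%N} /\
    forall i, i \in enum I ->
      forall a b, (a <= b)%N -> (f (g a) i <= f (g b) i)%N.
  elim: (enum I) => [|i r [g [g_lt Hg]]]; first by exists id; split.
  have [g' [g'_lt Hg']] := nondecreasing_subseq (fun a => f (g a) i).
  exists (g \o g'); split=> [a b ab|j]; first by apply: g_lt; apply: g'_lt.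
  rewrite inE => /predU1P[->|jr] a b ab /=; first exact: Hg'.
  by apply: Hg => //; exact: (ltnW_homo g'_lt).
exists (g 0%N), (g 1%N); split=> [|i]; first exact: (g_lt 0%N 1%N).
by apply: Hg => //; rewrite mem_enum.
Qed.

(** * The cone of directions and niceness *)

Section Cone.
Variables (l : nat) (D : cbraid l) (iota : signs D).

(* The integral directions along which the labels of a state can be changed;
   the states are the integral points of a translate of this cone. *)
Definition in_cone (u : segment D -> int) : Prop :=
  [/\ conserved u,
      forall e, if iota e then 0 <= u e else u e <= 0,
      forall c, iota (o_in c) = iota (o_out c) -> u (o_out c) <= u (o_in c) &
      u (bottom ord0) = 0].

(** The order of the two labels matters only when their signs agree: passing from - to + is always
    allowed, from + to - never. *)
Lemma good_labels_shift (R : realType) (a b : bool) (x y z t : R) (n : nat) :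
  (if a then 0 <= x else x < 0) -> (if b then 0 <= y else y < 0) ->
  (if a then 0 <= z else z <= 0) -> (if b then 0 <= t else t <= 0) ->
  (a = b -> t <= z) ->
  good_labels x y -> good_labels (x + n%:R * z) (y + n%:R * t).
Proof.
move=> Hx Hy Hz Ht Hzt; rewrite /good_labels; have n0 : 0 <= n%:R :> R by [].
have pos (v w : R) : 0 <= v -> 0 <= w -> 0 <= v + n%:R * w.
  by move=> v0 w0; rewrite addr_ge0 ?mulr_ge0.
have neg (v w : R) : v < 0 -> w <= 0 -> v + n%:R * w < 0.
  by move=> v0 w0; rewrite ltr_wnDr // mulr_ge0_le0.
case: a b Hx Hy Hz Ht Hzt => [] [] Hx Hy Hz Ht Hzt; last first.
- have xn := neg _ _ Hx Hz; have yn := neg _ _ Hy Ht.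
  rewrite Hx xn !leNgt Hy yn /= !andbF !orbF -!leNgt => yx.
  by rewrite lerD // ler_wpM2l // Hzt.
- by rewrite pos // neg // !orbT.
- by rewrite (ltNge x) Hx (leNgt 0 y) Hy /= !andbF.
rewrite !ltNge !pos // Hx Hy /= !andbT !orbF => yx.
by rewrite lerD // ler_wpM2l // Hzt.
Qed.

(* If height u <= 0, the half-line from a point of Q_N in the direction u stays
   in Q_N. *)
Lemma nice_height_gt0 (R : realType) (u : segment D -> int) e :
  nice R iota -> in_cone u -> u e != 0 -> 0 < height u.
Proof.
move=> [N [[s1 [[[sgn1 cons1] good1 bot1] s1N]] [B bound]]].
move=> [cons_u sgn_u ord_u bot_u] ue; rewrite ltNge; apply/negP => hu.
pose s (t : nat) : {ffun segment D -> R} :=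
  [ffun e => s1 e + t%:R * (u e)%:~R].
have sgn_uR e' : if iota e' then 0 <= (u e')%:~R :> R else (u e')%:~R <= 0 :> R.
  by have := sgn_u e'; case: ifP => _; rewrite ?ler0z ?lerz0.
have cons_s t : conserved (s t).
  move=> c; rewrite !ffunE addrACA -mulrDr -intrD cons_u cons1 intrD; ring.
have sQ t : QN iota N (s t).
  split; last first.
    apply: le_trans s1N; rewrite !sum_mindeg // ler_pM2r ?invr_gt0 ?ltr0n //.
    rewrite lerD2l.
    have -> : height (s t) = height (fun e => s1 e + t%:R * (u e)%:~R).
      by congr height; apply/funext => e'; rewrite ffunE.
    rewrite height_lin height_intr gerDl.
    by rewrite mulr_ge0_le0 // lerz0.
  split.
  - split=> [e'|]; last exact: cons_s.
    rewrite ffunE; have := sgn1 e'; have := sgn_uR e'.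
    case: ifP => _ ur sr; first by rewrite addr_ge0 ?mulr_ge0.
    by rewrite ltr_wnDr // mulr_ge0_le0.
  - move=> c; have := good1 c.
    have sh := good_labels_shift t (sgn1 (o_in c)) (sgn1 (o_out c))
      (sgn_uR (o_in c)) (sgn_uR (o_out c)).
    have {}sh := sh _; rewrite !ffunE.
    move: (ord_u c) sh; rewrite /o_in /o_out; case: ifP => _ uc sh; apply: sh;
    by move=> /uc; rewrite ler_int.
  - by rewrite ffunE bot_u mulr0 addr0.
have B1 : `|s1 e| <= B.
  by have := bound _ (sQ 0%N) e; rewrite ffunE mul0r addr0.
(* Since [u e] is a nonzero integer and [s1 e] is at most B in absolute value, t > 2B pushes the
   label at [e] beyond B. *)
have [t Bt] : exists t : nat, B + B < t%:R.
  exists (Num.truncn (B + B)).+1; exact: truncnS_gt.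
have := bound _ (sQ t) e; rewrite ffunE; apply/negP; rewrite -ltNge.
have u1 : 1 <= `|(u e)%:~R| :> R.
  by rewrite -intr_norm ler1z; move: ue; lia.
have tu : t%:R <= `|t%:R * (u e)%:~R| :> R.
  by rewrite normrM normr_nat ler_peMr.
have := ler_normB (s1 e + t%:R * (u e)%:~R) (s1 e).
rewrite addrAC subrr add0r; lra.
Qed.

End Cone.

Lemma Rpos_good (l : nat) (x y : 'I_l) (i j i' j' : int) k :
  Rpos x y i j i' j' k != 0 -> good_labels i j'.
Proof.
rewrite /Rpos /good_labels; case: ifP => [/orP[H|H]|_].
- by move=> _; apply/or3P; apply: Or31.
- by move=> _; apply/or3P; apply: Or32.
- by case: ifP => [H _|_]; [apply/or3P; apply: Or33|rewrite eqxx].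
Qed.

Lemma Rneg_good (l : nat) (x y : 'I_l) (i j i' j' : int) k :
  Rneg x y i j i' j' k != 0 -> good_labels j i'.
Proof.
rewrite /Rneg /good_labels; case: ifP => [/orP[H|H]|_].
- by move=> _; apply/or3P; apply: Or31.
- by move=> _; apply/or3P; apply: Or32.
- by case: ifP => [H _|_]; [apply/or3P; apply: Or33|rewrite eqxx].
Qed.

(** * States as points of the cone, and summability *)

Section States.
Variables (l : nat) (D : cbraid l) (iota : signs D).

Lemma valid_good (s : state D) c :
  valid s -> good_labels (s (o_in c)) (s (o_out c)).
Proof.
move=> /(_ c)[k]; rewrite /Rweight /o_in /o_out.
by case: ifP => _; [exact: Rpos_good|exact: Rneg_good].
Qed.

Lemma good_labels_same_sign (a b : bool) (x y : int) :
  (if a then 0 <= x else x < 0) -> (if b then 0 <= y else y < 0) ->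
  good_labels x y -> a = b -> y <= x.
Proof. by rewrite /good_labels => Hx Hy H E; subst b; case: a Hx Hy; lia. Qed.

(** With signs fixed, growth of absolute values means moving away from the ground label; the drop
    along an overstrand is nonnegative when its two signs agree. Natural-number coordinates thus
    detect the cone, as Dickson's lemma requires. *)
Lemma Omega_sub_cone (s t : state D) :
  Omega iota s -> Omega iota t ->
  (forall e, (`|s e| <= `|t e|)%N) ->
  (forall c, (`|s (o_in c) - s (o_out c)| <= `|t (o_in c) - t (o_out c)|)%N) ->
  in_cone iota (fun e => t e - s e).
Proof.
move=> [[sgn_s cons_s] val_s bot_s] [[sgn_t cons_t] val_t bot_t] st st'.
split=> [c|e|c E|].
- by rewrite addrACA -opprD addrACA -opprD cons_s cons_t.
- have := sgn_s e; have := sgn_t e; have := st e => /=.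
  by move: (s e) (t e); case: (iota e); lia.
- have := good_labels_same_sign (sgn_s _) (sgn_s _) (valid_good c val_s) E.
  have := good_labels_same_sign (sgn_t _) (sgn_t _) (valid_good c val_t) E.
  have := st' c; rewrite /=.
  move: (s (o_in c)) (s (o_out c)) (t (o_in c)) (t (o_out c)); lia.
- by rewrite bot_s bot_t subrr.
Qed.

Lemma ground_conserved :
  inversion_datum iota -> conserved (ground int iota).
Proof.
move=> Hi c; have := Hi c; rewrite /ground !inE !xpair_eqE.
move: (iota (bl c)) (iota (br c)) (iota (tl c)) (iota (tr c)).
by case: ifP => _ [] [] [] [].
Qed.

(** An integral negative label is at most -1, and the ground label is constant along an overstrand
    whose two signs agree. *)
Lemma Omega_ground_cone (s : state D) :
  inversion_datum iota -> Omega iota s ->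
  in_cone iota (fun e => s e - ground int iota e).
Proof.
move=> Hi [[sgn_s cons_s] val_s bot_s].
split=> [c|e|c E|].
- by rewrite addrACA -opprD addrACA -opprD cons_s ground_conserved.
- by have := sgn_s e; rewrite /ground; move: (s e) => /=; case: (iota e); lia.
- have := good_labels_same_sign (sgn_s _) (sgn_s _) (valid_good c val_s) E.
  by rewrite /ground E /= lerD2r.
- by rewrite bot_s subrr.
Qed.

Lemma heightB (s t : segment D -> int) :
  height (fun e => t e - s e) = height t - height s.
Proof.
have -> : (fun e => t e - s e) = (fun e => t e + -1 * s e).
  by apply/funext => e; rewrite mulN1r.
by rewrite height_lin mulN1r.
Qed.

Lemma nice_height_ge0 (R : realType) (u : segment D -> int) :
  nice R iota -> in_cone iota u -> 0 <= height u.
Proof.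
move=> Hnice Hu; have [[e ue]|nz] := pselect (exists e, u e != 0).
  exact/ltW/(nice_height_gt0 Hnice Hu ue).
rewrite /height big1 // => c _.
have u0 e : u e = 0.
  by apply/eqP; apply: contrapT => /negP ue; apply: nz; exists e.
by rewrite !u0 addr0 /signed; case: ifP; rewrite ?oppr0.
Qed.

(** An infinite set of terms would contain an injective sequence; Dickson's lemma yields two indices
    [a < b] whose terms are forced to coincide. *)
Lemma nice_diag_summable (R : realType) : nice R iota -> diag_summable iota.
Proof.
move=> Hnice d; apply: contrapT => /infiniteP/card_leP[g].
pose f a := val (g (to_setT a)); have f_inj : injective f.
  move=> a b /val_inj/(inj (mem_set I) (mem_set I)); exact: (congr1 val).
pose s a : state D := (f a).1; pose k a : expo l := (f a).2.
have Hf a : [/\ Omega iota (s a), tdeg (k a) = d & P (s a) (k a) != 0].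
  exact: (set_mem (valP (g (to_setT a)))).
have /choice[n Hn] : forall a, exists n : {ffun 'I_l -> nat},
    forall i, k a i = state_expo (s a) i + (n i)%:R.
  by move=> a; have [_ _] := Hf a; apply: (graded_P (s a) (k a)).1.
(* If the coordinates grow from a to b, the labels change along the cone,
   while the total degree d is the sum of a constant, half the height and n; so
   neither the height nor n can grow. *)
pose coord a (i : segment D + crossing D + 'I_l) : nat := match i with
  | inl (inl e) => `|s a e|%N
  | inl (inr c) => `|s a (o_in c) - s a (o_out c)|%N
  | inr i => n a i end.
have [a [b [ab leab]]] := dickson coord.
have [Oa da _] := Hf a; have [Ob db _] := Hf b.
have Hu := Omega_sub_cone Oa Ob (fun e => leab (inl (inl e)))
  (fun c => leab (inl (inr c))).
have ht0 := nice_height_ge0 Hnice Hu.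
have degk c : d = (writhe D rat - (width D)%:R + (height (s c))%:~R) / 2%:R +
    (\sum_i n c i)%N%:R.
  have [[[_ cons_c] _ _] dc _] := Hf c.
  rewrite -tdeg_state_expo // natr_sum -big_split /= -dc /tdeg.
  by apply: eq_bigr => i _; rewrite Hn.
have le_n i : true -> (n a i <= n b i)%N by move=> _; exact: (leab (inr i)).
have [ht_eq n_eq] : height (fun e => s b e - s a e) = 0 /\
    (\sum_i n a i = \sum_i n b i)%N.
  have le_sum : (\sum_i n a i <= \sum_i n b i)%N by exact: leq_sum.
  move: ht0; rewrite heightB.
  have := degk a; rewrite {1}(degk b).
  set ha := height (s a); set hb := height (s b) => E hab.
  have E2 : hb + 2 * (\sum_i n b i)%N%:Z = ha + 2 * (\sum_i n a i)%N%:Z.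
    apply/eqP; rewrite -(eqr_int rat) !intrD !intrM; apply/eqP.
    move: E; rewrite -!pmulrn; lra.
  split; lia.
have sab : s a = s b.
  apply/ffunP => e; apply/eqP; apply: contraT => ne.
  have ue : s b e - s a e != 0 by rewrite subr_eq0 eq_sym.
  by have := nice_height_gt0 Hnice Hu ue; rewrite ht_eq.
have nab i : n a i = n b i.
  have := leqif_sum (fun i (_ : true) => leqif_eq (le_n i isT)).
  by case=> _; rewrite n_eq eqxx => /esym/forallP/(_ i)/eqP.
have kab : k a = k b by apply/ffunP => i; rewrite !Hn sab nab.
have fab : f a = f b.
  rewrite [LHS]surjective_pairing [RHS]surjective_pairing.
  by rewrite -/(s a) -/(k a) sab kab.
by move: ab; rewrite (f_inj _ _ fab) ltnn.
Qed.

End States.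

(** * The degree of the ground state *)

Section FractionDegree.
Variable l : nat.

Definition diag_poly (p : {mpoly int[l]}) : {poly int} :=
  mmap (polyC : int -> {poly int}) (fun=> 'X) p.

Lemma diag_polyM p p' : diag_poly (p * p') = diag_poly p * diag_poly p'.
Proof. exact: rmorphM. Qed.

Lemma diag_poly1 : diag_poly 1 = 1.
Proof. exact: rmorph1. Qed.

Lemma diag_polyN p : diag_poly (- p) = - diag_poly p.
Proof. exact: rmorphN. Qed.

Lemma diag_polyB p p' : diag_poly (p - p') = diag_poly p - diag_poly p'.
Proof. exact: rmorphB. Qed.

Lemma diag_polyX i : diag_poly 'X_i = 'X.
Proof. by rewrite /diag_poly mmapX mmap1U. Qed.

Lemma diag_poly_neq0 P U a : diag_poly P = U * 'X^a -> U.[0] != 0 -> P != 0.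
Proof.
move=> HP; apply: contra_neq => P0; apply/eqP; move: HP.
rewrite P0 {1}/diag_poly mmap0 => /esym/eqP.
by rewrite mulf_eq0 expf_eq0 polyX_eq0 andbF orbF => /eqP->; rewrite horner0.
Qed.

(* z is the order at x = 0 of the fraction f evaluated at (x, ..., x). *)
Definition diag_order (f : {fraction {mpoly int[l]}}) (z : int) : Prop :=
  exists (P Q : {mpoly int[l]}) (U V : {poly int}) (a b : nat),
    [/\ f = tofrac P / tofrac Q, diag_poly P = U * 'X^a /\ U.[0] != 0,
        diag_poly Q = V * 'X^b /\ V.[0] != 0 & z = a%:Z - b%:Z].

Lemma diag_order_poly P U a :
  diag_poly P = U * 'X^a -> U.[0] != 0 -> diag_order (tofrac P) a%:Z.
Proof.
move=> HP HU; exists P, 1, U, 1, a, 0%N; split=> //.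
- by rewrite tofrac1 divr1.
- by rewrite diag_poly1 expr0 mulr1 hornerC oner_neq0.
- by rewrite subr0.
Qed.

Lemma diag_orderM f z f' z' :
  diag_order f z -> diag_order f' z' -> diag_order (f * f') (z + z').
Proof.
move=> [P [Q [U [V [a [b [-> [HP HU] [HQ HV] ->]]]]]]].
move=> [P' [Q' [U' [V' [a' [b' [-> [HP' HU'] [HQ' HV'] ->]]]]]]].
exists (P * P'), (Q * Q'), (U * U'), (V * V'), (a + a')%N, (b + b')%N.
split.
- by rewrite mulf_div !tofracM.
- by rewrite diag_polyM HP HP' exprD mulrACA hornerM mulf_neq0.
- by rewrite diag_polyM HQ HQ' exprD mulrACA hornerM mulf_neq0.
- by rewrite !PoszD; ring.
Qed.

Lemma diag_orderV f z : diag_order f z -> diag_order f^-1 (- z).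
Proof.
move=> [P [Q [U [V [a [b [-> HP HQ ->]]]]]]].
by exists Q, P, V, U, b, a; split=> //; [rewrite invf_div|rewrite opprB].
Qed.

Lemma diag_order1 : diag_order 1 0.
Proof.
rewrite -tofrac1; apply: (@diag_order_poly 1 1 0).
  by rewrite diag_poly1 expr0 mulr1.
by rewrite hornerC oner_neq0.
Qed.

Lemma diag_orderN1 : diag_order (-1) 0.
Proof.
rewrite -tofrac1 -tofracN; apply: (@diag_order_poly (-1) (-1) 0).
  by rewrite diag_polyN diag_poly1 expr0 mulr1.
by rewrite hornerN hornerC oppr_eq0 oner_neq0.
Qed.

Lemma diag_orderX i : diag_order (xfrac i) 1.
Proof.
apply: (@diag_order_poly 'X_i 1 1); first by rewrite diag_polyX mul1r.
by rewrite hornerC oner_neq0.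
Qed.

Lemma diag_order_1BX i : diag_order (1 - xfrac i) 0.
Proof.
rewrite -tofrac1 -tofracB; apply: (@diag_order_poly (1 - 'X_i) (1 - 'X) 0).
  by rewrite diag_polyB diag_poly1 diag_polyX expr0 mulr1.
by rewrite !hornerE oner_neq0.
Qed.

Lemma diag_order_1BXV i : diag_order (1 - (xfrac i)^-1) (-1).
Proof.
have X0 : xfrac i != 0.
  rewrite tofrac_eq0; apply: (@diag_poly_neq0 _ 1 1).
    by rewrite diag_polyX mul1r.
  by rewrite hornerC oner_neq0.
have -> : 1 - (xfrac i)^-1 = -1 * (1 - xfrac i) * (xfrac i)^-1.
  by rewrite mulN1r opprB mulrBl mul1r divff.
rewrite -[-1 : int]add0r -[X in X - 1]addr0.
apply: diag_orderM (diag_orderV (diag_orderX i)).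
exact: diag_orderM diag_orderN1 (diag_order_1BX i).
Qed.

Lemma diag_order_prod (I : Type) (r : seq I) f z :
  (forall i, diag_order (f i) (z i)) ->
  diag_order (\prod_(i <- r) f i) (\sum_(i <- r) z i).
Proof.
move=> H; apply: (big_rec2 (fun f z => diag_order f z)).
  exact: diag_order1.
by move=> i z' f' _; apply: diag_orderM.
Qed.

Lemma diag_order_expn f z n : diag_order f z -> diag_order (f ^+ n) (z *+ n).
Proof.
move=> H; elim: n => [|n IH]; first by rewrite expr0; exact: diag_order1.
by rewrite exprS mulrS; apply: diag_orderM.
Qed.

Lemma diag_order_exp f z (n : int) :
  diag_order f z -> diag_order (f ^ n) (n * z).
Proof.
have E (k : nat) : k%:Z * z = z *+ k by rewrite -mulr_natl natz.
case: n => n H; first by rewrite E; exact: diag_order_expn.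
by rewrite NegzE -exprnN mulNr E; apply/diag_orderV/diag_order_expn.
Qed.

Lemma horner0_mulX_inj (U V : {poly int}) a b :
  U.[0] != 0 -> V.[0] != 0 -> U * 'X^a = V * 'X^b -> a = b.
Proof.
wlog: U V a b / (a <= b)%N => [H HU HV E|ab HU HV].
  case: (leqP a b) => [|/ltnW] ab; first exact: H E.
  by apply/esym; exact: H (esym E).
have X0 : 'X^a != 0 :> {poly int} by rewrite expf_neq0 // polyX_eq0.
rewrite -{1}(subnK ab) exprD mulrA => /(mulIf X0) EU; move: HU.
rewrite EU hornerM hornerXn expr0n mulf_eq0 negb_or => /andP[_].
by case: (eqVneq (b - a)%N 0%N) => [|_]; [lia|move=> /eqP].
Qed.

(** Cross-multiplication gives an identity of polynomials, which can be evaluated at (x, ..., x);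
    the powers of x on both sides are then compared. *)
Lemma diag_order_uniq f z z' : diag_order f z -> diag_order f z' -> z = z'.
Proof.
move=> [P [Q [U [V [a [b [-> [HP HU] [HQ HV] ->]]]]]]].
move=> [P' [Q' [U' [V' [a' [b' [E [HP' HU'] [HQ' HV'] ->]]]]]]].
have Q0 := diag_poly_neq0 HQ HV; have Q0' := diag_poly_neq0 HQ' HV'.
move: E => /eqP; rewrite eqr_div ?tofrac_eq0 // -!tofracM tofrac_eq => /eqP.
move=> /(congr1 diag_poly); rewrite !diag_polyM HP HQ' HP' HQ.
rewrite mulrACA [RHS]mulrACA -!exprD.
move=> /horner0_mulX_inj; rewrite !hornerM !mulf_neq0 // => /(_ isT isT).
lia.
Qed.

End FractionDegree.

(** * Comparison of the ground state with rho and the exponents of W *)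

Section LeadingExponent.
Variables (l : nat) (D : cbraid l) (iota : signs D).
Local Notation n := (width D).

(** Each crossing has one over- and one understrand component, so the linking numbers add up to the
    writhe. *)
Lemma sum_rho :
  \sum_i rho D i = (n.+1%:R - writhe D rat) / 2%:R.
Proof.
have pick (k : 'I_l) : \sum_i (k == i)%:R = 1 :> rat.
  rewrite (bigD1 k) //= eqxx big1 ?addr0 // => i.
  by rewrite eq_sym => /negbTE->.
rewrite /rho -mulr_suml sumrB; congr ((_ - _) / _).
  rewrite -natr_sum; congr (_%:R).
  rewrite -[RHS](card_ord n.+1) -sum1_card (partition_big (colour D) predT) //=.
  apply: eq_bigr => i _; rewrite -sum1_card.
  by apply: eq_bigl => r; rewrite inE.
(* One formula for both cases: when i = j the two products coincide and compensate the factor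
   1/2. *)
have lkE i j : lk D i j = \sum_(c : crossing D) csign c / 2%:R *
    ((kover c == i)%:R * (kunder c == j)%:R +
     (kover c == j)%:R * (kunder c == i)%:R).
  rewrite /lk; case: eqVneq => [<-|ij].
    rewrite big_mkcond; apply: eq_bigr => c _.
    by case: eqP => _; case: eqP => _ /=; field.
  rewrite big_mkcond mulr_suml; apply: eq_bigr => c _.
  case: (eqVneq (kover c) i) => [->|_]; case: (eqVneq (kunder c) j) => [->|_].
  - by rewrite (negbTE ij) /= ?[j == i]eq_sym ?(negbTE ij); field.
  - by rewrite (negbTE ij) /=; field.
  - by rewrite [j == i]eq_sym (negbTE ij) andbF /=; field.
  - by case: eqP => _; case: eqP => _ /=; field.
under eq_bigr do under eq_bigr do rewrite lkE.
under eq_bigr do rewrite exchange_big /=.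
rewrite exchange_big /= /writhe; apply: eq_bigr => c _.
under eq_bigr do rewrite -mulr_sumr big_split /= -mulr_sumr -mulr_suml !pick.
rewrite -mulr_sumr big_split /= -!mulr_suml -mulr_sumr !pick /csign /signed.
by case: ifP => _; field.
Qed.

(* On an inversion datum, a positive crossing has a step o -> o^+ iff its
   top-right segment is a - segment, and a negative one has a step from o iff
   its bottom-right segment is. *)
Definition W_order (c : crossing D) : int :=
  if positive c then - ground int iota (tr c) else ground int iota (br c).

(** A check of the admissible sign patterns: the steps from o to o^+ and to u^+ have orders 1 and 0
    at a positive crossing, and both have order -1 at a negative one. *)
Lemma W_diag_order :
  inversion_datum iota -> diag_order (W iota) (\sum_c W_order c).
Proof.
move=> Hi; apply: diag_order_prod => c.
have := Hi c; rewrite /W_order /ground /step_oo /step_ou.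
rewrite /o_in /o_out /u_in /u_out !inE !xpair_eqE.
have dX := diag_orderX; have d1 := diag_order1 l.
have dXV k := diag_orderV (dX l k).
have dneg (k k' : 'I_l) :
    diag_order (xfrac k / xfrac k' * (1 - (xfrac k)^-1)) (-1 : int).
  by have := diag_orderM (diag_orderM (dX l k) (dXV k')) (diag_order_1BXV k).
case: (positive c);
  move: (iota (bl c)) (iota (br c)) (iota (tl c)) (iota (tr c));
  move=> [] [] [] [] //= _;
  rewrite ?mulr1 ?mul1r ?opprK ?oppr0 //;
  solve [exact: dX | exact: dXV | exact: d1 | exact: dneg
        | exact: diag_order_1BX].
Qed.

(** The factors 1 - x_i have order 0, so the order of [W iota] is the sum of the [a i]. The
    vanishing sum of j' - j converts twice the sum of [W_order] into the height. *)
Lemma sum_W_exponents a :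
  inversion_datum iota -> W_exponents iota a ->
  2 * \sum_i a i = - height (ground int iota).
Proof.
move=> Hi [sgn [b WE]].
have -> : \sum_i a i = \sum_c W_order c.
  apply: (diag_order_uniq _ (W_diag_order Hi)); rewrite WE.
  have -> : \sum_i a i = 0 + \sum_i a i * 1 + \sum_(i < l) 0 *+ b i.
    rewrite [X in _ = _ + X]big1 => [|i _]; last by rewrite mul0rn.
    by rewrite add0r addr0; apply: eq_bigr => i _; rewrite mulr1.
  apply: diag_orderM; [apply: diag_orderM|].
  - case: (sgn); rewrite ?expr1 ?expr0; first exact: diag_orderN1.
    exact: diag_order1.
  - by apply: diag_order_prod => i; exact/diag_order_exp/diag_orderX.
  - by apply: diag_order_prod => i; exact/diag_order_expn/diag_order_1BX.
have /eqP := sum_right_labels (ground_conserved Hi).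
rewrite -subr_eq0 -sumrB => /eqP E; apply/esym.
apply: etrans (_ : - height (ground int iota) -
  \sum_c (ground int iota (tr c) - ground int iota (br c)) = _).
  by rewrite E subr0.
rewrite /height -sumrN -sumrB mulr_sumr; apply: eq_bigr => c _.
by rewrite /W_order /signed; case: ifP => _; ring.
Qed.

End LeadingExponent.

Lemma hlaurent_even (K : fieldType) (h : K) z w a :
  h != 0 -> hlaurent h (z + 2 * w) a -> hlaurent h z a.
Proof.
move=> h0 [c lc ->]; exists ((h ^+ 2) ^ w * c).
  by apply: laurentM lc; exact: laurentz.
by rewrite expfzDr // -[h ^+ 2]/(h ^ (2 : int)) exprz_exp mulrA.
Qed.

(** * The state sum *)

Section StateSum.
Variables (l : nat) (D : cbraid l) (iota : signs D).

Lemma hlaurent_F (k : expo l) : is_link D -> hlaurent qh l.-1%:Z (F iota k).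
Proof.
move=> HD; apply: (hlaurent_sum qh_neq0) => m _.
have mulh z f a b : laurent (qh ^+ 2) b -> hlaurent qh z a ->
    f = b * a -> hlaurent qh z f.
  by move=> lb [c lc ->] ->; exists (b * c); [exact: laurentM|rewrite mulrCA].
apply: (mulh _ _ _ _ _ _ erefl).
  apply: (laurentB q_neq0); rewrite /smono; case: ifP => _;
  solve [exact: laurent0|exact: laurent1].
apply: (mulh _ _ _ _ _ _ erefl).
  by apply: laurentX; exact: (laurentC _ (-1)).
apply: (hlaurent_sum qh_neq0) => s [[_ cons_s] _ _].
have [z Ez] := state_qexpo_parity HD cons_s.
apply: (hlaurent_even qh_neq0 (w := z)); rewrite -Ez.
exact: (graded_P s _).2.
Qed.

(** The constants combine: -1/2 from the prefactor and (writhe - n) / 2 give minus the sum of rho,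
    and half the ground height gives minus the sum of [a]. *)
Lemma F_degree (R : realType) (k : expo l) (a : {ffun 'I_l -> int}) :
  inversion_datum iota -> nice R iota -> W_exponents iota a ->
  F iota k != 0 ->
  exists t : nat, tdeg k = t%:R - \sum_i (rho D i + (a i)%:~R).
Proof.
move=> Hi Hnice Ha /fsum_neq0[m _]; rewrite mulf_eq0 negb_or => /andP[m0].
rewrite mulf_eq0 negb_or => /andP[_ /fsum_neq0[s Os Ps]].
have [b Eb] : exists b : bool, tdeg m = b%:R - 1 / 2%:R.
  move: m0; rewrite /smono.
  have [->|_] := eqVneq m (xe _ (1 / 2%:R)).
    by move=> _; exists true; rewrite tdeg_xe /=; field.
  have [->|_] := eqVneq m (xe _ (- (1 / 2%:R))).
    by move=> _; exists false; rewrite tdeg_xe /=; field.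
  by rewrite subrr eqxx.
have [n Hn] := (graded_P s _).1 Ps.
have Hu := Omega_ground_cone Hi Os.
have [[_ cons_s] _ _] := Os.
have [z Ez] := height_even (let: And4 Hu _ _ _ := Hu in Hu).
have z0 : 0 <= z by have := nice_height_ge0 Hnice Hu; rewrite Ez; lia.
have Ehs : height s = height (ground int iota) + 2 * z.
  by rewrite -Ez heightB addrC subrK.
(* The bit [b] tells which term of the prefactor occurs, [z] is half the height above the ground
   state, and [n] is the excess over the lower exponent of [P s]. *)
exists (b + `|z| + \sum_i n i)%N.
have -> : tdeg k = tdeg m + (tdeg (state_expo s) + (\sum_i n i)%N%:R).
  rewrite /tdeg natr_sum -!big_split /=; apply: eq_bigr => i _.
  by rewrite -Hn !ffunE addrC subrK.
rewrite tdeg_state_expo // Eb Ehs big_split /= sum_rho !natrD.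
have -> : (`|z|%N)%:R = z%:~R :> rat by rewrite pmulrn; congr (_%:~R); lia.
have Ea : 2 * \sum_i (a i)%:~R = - (height (ground int iota))%:~R :> rat.
  by rewrite -rmorph_sum /= -[2]/(2%:~R) -intrM (sum_W_exponents Hi Ha) rmorphN.
have -> : \sum_i (a i)%:~R = - (height (ground int iota))%:~R / 2 :> rat.
  by rewrite -Ea; field.
by rewrite intrD intrM -natr1; field.
Qed.

End StateSum.

Theorem theorem4p16 (R : realType) (l : nat) (L : cbraid l)
    (Delta : series int l) (v : expo l) :
  is_link L ->
  alexander L Delta ->
  GG R L Delta v ->
  unique_minimizer Delta v ->
  forall (D : cbraid l) (iota : signs D),
    presents R L v iota ->
    [/\ diag_summable iota,
        (forall d : rat, in_shifted_Zq l (diag_eval (F iota) d)) &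
        (forall d : rat, diag_eval (F iota) d != 0 ->
           exists k : nat, d = - tdeg v / 2%:R + k%:R)].
Proof.
move=> _ _ _ _ D iota [[HD _] _ Hi Hnice [a Ha Hv]]; split=> [|d|d].
- exact: nice_diag_summable Hnice.
- by apply: (hlaurent_sum qh_neq0 (z := l.-1%:Z)) => k _; exact: hlaurent_F.
- move=> /fsum_neq0[k <- /(F_degree Hi Hnice Ha)[t ->]]; exists t.
  rewrite addrC; congr (_ + _); rewrite mulNr /tdeg mulr_suml; congr (- _).
  by apply: eq_bigr => i _; rewrite -Hv ffunE.
Qed.
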